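(* Let $E\subseteq F$ be smooth countable Borel equivalence relations on a standard Borel space $X$, and $E'\subseteq F'$ smooth countable Borel equivalence relations on a standard Borel space $Y$. Then $(E,F)\leq_B(E',F')$ if and only if $\mathrm{crs}(E,F)\leq\mathrm{crs}(E',F')$ (pointwise). In particular, $(E,F)$ and $(E',F')$ are simultaneously Borel bireducible if and only if $\mathrm{crs}(E,F)=\mathrm{crs}(E',F')$.
   Context: A countable Borel equivalence relation on a standard Borel space $X$ is an equivalence relation that is a Borel subset of $X\times X$ with all classes countable; it is smooth if there are a standard Borel space $Z$ and a Borel $f:X\to Z$ with $x\mathrel{E}y\iff f(x)=f(y)$. $(E,F)\leq_B(E',F')$ means there is a Borel map $f:X\to Y$ such that for all $x,y\in X$, $x\mathrel{E}y\iff f(x)\mathrel{E'}f(y)$ and $x\mathrel{F}y\iff f(x)\mathrel{F'}f(y)$ (a simultaneous Borel reduction); bireducible means reductions exist in both directions. For $1\leq m\leq\omega$, $n_{\geq m}(E,F)$ is the number of $F$-classes containing at least $m$ distinct $E$-classes (for $m=\omega$: infinitely many), and the coarse relative shape is $\mathrm{crs}(E,F)=\langle n_{\geq m}(E,F):1\leq m\leq\omega\rangle$. *)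

(* Defs.v *)
From HB Require Import structures.
From mathcomp Require Import all_boot all_order all_algebra.
From mathcomp Require Import all_classical all_reals all_analysis.
From Corelib Require Import RelationClasses.

Set Implicit Arguments.
Unset Strict Implicit.
Unset Printing Implicit Defensive.

Local Open Scope classical_set_scope.
Local Open Scope card_scope.

Definition polish (R : realType) (M : metricType R) : Prop :=
  (exists2 D : set M, countable D & dense D) /\
  (forall u : nat -> M, cauchy (u @ \oo) -> exists l : M, u @ \oo --> l).

(* [completeType] and [measurableType] are pointed; completeness above and the
   sigma-algebras below are stated on bare types so that the empty standard
   Borel space is allowed.
   A measurable space is standard Borel when it is isomorphic to a Polish space
   equipped with the sigma-algebra generated by its open sets. *)
Definition is_standard_borel (R : realType) (T : Type) (S : set (set T)) : Prop :=
  exists M : metricType R, polish M /\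
    exists f : T -> M, bijective f /\
      S = [set f @^-1` B | B in <<s @open M >>].

Record standardBorelType (R : realType) := StandardBorelType {
  standardBorel_sort :> Type;
  borel : set (set standardBorel_sort);
  borelP : is_standard_borel R borel
}.

Arguments borel {R} s _.

Definition borel_fun (R : realType) (X Y : standardBorelType R) (f : X -> Y) :
    Prop :=
  forall B : set Y, borel Y B -> borel X (f @^-1` B).

Definition borel_prod (R : realType) (X Y : standardBorelType R) :
    set (set (X * Y)) :=
  <<s [set A `*` B | A in borel X & B in borel Y] >>.

Arguments borel_prod {R} X Y _.

Definition countable_borel_equiv (R : realType) (X : standardBorelType R)
    (E : X -> X -> Prop) : Prop :=
  [/\ Equivalence E,
      borel_prod X X [set p | E p.1 p.2]
    & forall x : X, countable [set y | E x y]].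

Definition smooth (R : realType) (X : standardBorelType R)
    (E : X -> X -> Prop) : Prop :=
  exists (Z : standardBorelType R) (f : X -> Z),
    borel_fun f /\ forall x y : X, E x y <-> f x = f y.

Definition simul_borel_reducible (R : realType) (X Y : standardBorelType R)
    (E F : X -> X -> Prop) (E' F' : Y -> Y -> Prop) : Prop :=
  exists f : X -> Y,
    [/\ borel_fun f,
        forall x y : X, E x y <-> E' (f x) (f y)
      & forall x y : X, F x y <-> F' (f x) (f y)].

Definition simul_borel_bireducible (R : realType) (X Y : standardBorelType R)
    (E F : X -> X -> Prop) (E' F' : Y -> Y -> Prop) : Prop :=
  simul_borel_reducible E F E' F' /\ simul_borel_reducible E' F' E F.

Definition equiv_classes (T : Type) (E : T -> T -> Prop) : set (set T) :=
  [set [set y | E x y] | x in [set: T]].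

Variant shape_index := Fin of nat | Omega.

(* The indices m with 1 <= m <= omega *)
Definition valid_shape_index (m : shape_index) : Prop :=
  match m with Fin k => (1 <= k)%N | Omega => True end.

Definition at_least (T : Type) (m : shape_index) (A : set T) : Prop :=
  match m with Fin k => `I_k #<= A | Omega => infinite_set A end.

(* The F-classes containing at least m distinct E-classes: the cardinality of
   this set is n_{>= m}(E, F). *)
Definition crs_classes (T : Type) (E F : T -> T -> Prop) (m : shape_index) :
    set (set T) :=
  [set C | equiv_classes F C /\
           at_least m [set A | equiv_classes E A /\ A `<=` C]].

(* As cardinals are not first-class objects in the library, the comparison and
   equality of the sequences crs(E, F) and crs(E', F') of cardinals are stated
   through injections and bijections between the sets being counted. *)
Definition crs_le (T U : Type) (E F : T -> T -> Prop) (E' F' : U -> U -> Prop) :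
    Prop :=
  forall m : shape_index, valid_shape_index m ->
    crs_classes E F m #<= crs_classes E' F' m.

Definition crs_eq (T U : Type) (E F : T -> T -> Prop) (E' F' : U -> U -> Prop) :
    Prop :=
  forall m : shape_index, valid_shape_index m ->
    crs_classes E F m #= crs_classes E' F' m.

(* Main.v *)
Require Import Defs.
From mathcomp Require Import finmap.
From mathcomp Require Import all_boot all_order all_algebra.
From mathcomp Require Import all_classical all_reals all_analysis.
From mathcomp Require Import zify.

(** Fix a smooth pair of relations, [E] contained in [F]. By the Lusin-Novikov
    theorem the [E]-classes inside each [F]-class can be numbered in a Borel way by
    an initial segment of the natural numbers, and by the Lusin-Souslin theorem the
    sets [D n] of (codes of) [F]-classes with more than [n] classes of [E] are Borel
    subsets of the Baire space. Up to Borel bireducibility the pair is thus a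
    decreasing sequence [D], and a reduction amounts to a Borel injection from
    [D 0] to [D' 0] mapping each [D n] to [D' n]. When some [D' n] is uncountable, its
    top layers contain Cantor sets which absorb everything of lower grade (perfect
    set theorem); what is left is countable, hence Borelness is automatic there,
    and a counting argument gives the injection.

    The Lusin-Novikov theorem is proved without ordinals: call a finite approximation
    of a Cantor set inside one fiber killable if it is not realized off a countable
    union of Borel partial sections. There are countably many approximations, and
    one all of whose extensions are killable is killable, because the points
    realizing it form an analytic partial section, which separation enlarges to a
    Borel one. A non-killable root would produce a Cantor set in a fiber. *)

Set Implicit Arguments.
Unset Strict Implicit.
Unset Printing Implicit Defensive.

Local Open Scope classical_set_scope.
Local Open Scope card_scope.

(** The comparison of shapes gives one injection per index, none assumed Borel and no two assumed
    compatible. They can only be exploited through cardinalities, from which a single graded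
    injection is rebuilt. A code [w] of an [F]-class is itself the argument of the Cantor embedding
    that absorbs it: this is why codes are kept binary, where such an embedding is injective. Given
    a graded injection on codes, the reduction keeps the number of an [E]-class, and a Borel
    transversal of [E'] selects a point in the class with that number above the image. Borelness of
    this selection, and of the layers, rests on splitting a countable-to-one map into countably many
    injective pieces, whose Borel images are Borel; Lusin-Novikov supplies the splitting, for points
    inside [E]-classes and for [E]-classes inside [F]-classes. *)

Lemma ex_choice (T U : Type) (P : T -> U -> Prop) :
  (forall x, exists y, P x y) -> exists f, forall x, P x (f x).
Proof. by move=> /choice[f hf]; exists f. Qed.

(** * Sigma-algebras: closure under countable logical connectives *)

Section SigmaAlgebraClosure.
Variables (T : Type) (S : set (set T)).
Hypothesis hS : sigma_algebra setT S.

Lemma sigma_not (A : T -> Prop) : S [set x | A x] -> S [set x | ~ A x].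
Proof.
by case: hS => _ hC _ /hC; rewrite setTD.
Qed.

(** Indexing by a [countType] lets quantifiers range directly over pairs, finite sequences and
    configurations. *)
Lemma sigma_ex (I : countType) (A : I -> T -> Prop) :
  (forall i, S [set x | A i x]) -> S [set x | exists i, A i x].
Proof.
case: hS => h0 _ hU hA.
have -> : [set x | exists i, A i x] =
    \bigcup_n [set x | if unpickle n is Some i then A i x else False].
  apply/seteqP; split => x /=.
  - by case=> i Aix; exists (pickle i) => //=; rewrite pickleK.
  - by case=> n _ /=; case: unpickle => // i Aix; exists i.
apply: hU => n; case: unpickle => [i|]; first exact: hA.
by rewrite [X in S X](_ : _ = set0) //; apply/seteqP; split.
Qed.

Lemma sigma_all (I : countType) (A : I -> T -> Prop) :
  (forall i, S [set x | A i x]) -> S [set x | forall i, A i x].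
Proof.
move=> hA.
have -> : [set x | forall i, A i x] = [set x | ~ exists i, ~ A i x].
  by apply/seteqP; split => x /= h; [case=> i; apply | move=> i;
    apply: contrapT => hi; apply: h; exists i].
by apply: sigma_not; apply: sigma_ex => i; apply: sigma_not.
Qed.

Lemma sigma_cst (P : Prop) : S [set _ | P].
Proof.
have h0 : S [set _ | False].
  by case: hS => h _ _; rewrite (_ : [set _ | False] = set0) //; apply/seteqP; split.
case: (pselect P) => p; last first.
  by rewrite (_ : [set _ | P] = [set _ | False]) //; apply/seteqP; split.
rewrite (_ : [set _ | P] = [set _ | ~ False]); first exact: sigma_not.
by apply/seteqP; split => x _ //.
Qed.

Lemma sigma_and (A B : T -> Prop) :
  S [set x | A x] -> S [set x | B x] -> S [set x | A x /\ B x].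
Proof.
move=> hA hB.
have -> : [set x | A x /\ B x] = [set x | forall b : bool, if b then A x else B x].
  by apply/seteqP; split => x /= => [[? ?] []|h] //; split; [exact: (h true)|exact: (h false)].
by apply: sigma_all => -[].
Qed.

Lemma sigma_or (A B : T -> Prop) :
  S [set x | A x] -> S [set x | B x] -> S [set x | A x \/ B x].
Proof.
move=> hA hB.
have -> : [set x | A x \/ B x] = [set x | exists b : bool, if b then A x else B x].
  apply/seteqP; split => x /=; first by case=> ?; [exists true|exists false].
  by case=> -[] ?; [left|right].
by apply: sigma_ex => -[].
Qed.

Lemma sigma_imp (A B : T -> Prop) :
  S [set x | A x] -> S [set x | B x] -> S [set x | A x -> B x].
Proof.
move=> hA hB.
have -> : [set x | A x -> B x] = [set x | ~ A x \/ B x].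
  apply/seteqP; split => x /=; last by case.
  by case: (pselect (A x)) => ? h; [right; apply: h|left].
by apply: sigma_or => //; apply: sigma_not.
Qed.

End SigmaAlgebraClosure.

(** * The Baire space *)

Definition baire := nat -> nat.

Definition agree n (a b : baire) := forall i, (i < n)%N -> a i = b i.

Definition closedN (K : set baire) :=
  forall a, (forall n, exists b, K b /\ agree n a b) -> K a.

Definition contN (h : baire -> baire) :=
  forall a n, exists m, forall b, agree m a b -> h a n = h b n.

Definition inj_on {U : Type} (K : set baire) (h : baire -> U) :=
  forall a b, K a -> K b -> h a = h b -> a = b.

(** The generators form a countable subbase of the product topology, so this is its Borel
    sigma-algebra. *)
Definition borelN : set (set baire) :=
  <<s [set A | exists i j, A = [set a | a i = j]] >>.

Lemma agreeW m n a b : (m <= n)%N -> agree n a b -> agree m a b.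
Proof. by move=> mn h i im; apply: h; apply: leq_trans mn. Qed.

Lemma agree_sym n a b : agree n a b -> agree n b a.
Proof. by move=> h i /h. Qed.

Lemma contN_agree h a n : contN h ->
  exists m, forall b, agree m a b -> agree n (h a) (h b).
Proof.
move=> hc; elim: n => [|n [m hm]]; first by exists 0%N.
have [m' hm'] := hc a n; exists (maxn m m') => b ab i.
rewrite ltnS leq_eqVlt => /orP[/eqP->|].
  by apply: hm'; apply: agreeW ab; apply: leq_maxr.
by apply: hm; apply: agreeW ab; apply: leq_maxl.
Qed.

Lemma contN_id : contN id.
Proof. by move=> a n; exists n.+1 => b; apply. Qed.

Lemma contN_comp h k : contN h -> contN k -> contN (h \o k).
Proof.
move=> hh hk a n; have [m hm] := hh (k a) n.
by have [m' hm'] := contN_agree a m hk; exists m' => b /hm'/hm.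
Qed.

Lemma closedN_all (I : Type) (K : I -> set baire) :
  (forall i, closedN (K i)) -> closedN [set a | forall i, K i a].
Proof.
by move=> hK a ha i; apply: hK => n; have [b [Kb ab]] := ha n; exists b.
Qed.

Lemma closedN_and (K L : set baire) :
  closedN K -> closedN L -> closedN [set a | K a /\ L a].
Proof.
move=> hK hL a ha; split; [apply: hK|apply: hL] => n;
  by have [b [[? ?] ?]] := ha n; exists b.
Qed.

Lemma closedN_preimage h (K : set baire) :
  contN h -> closedN K -> closedN [set a | K (h a)].
Proof.
move=> hc hK a ha; apply: hK => n; have [m hm] := contN_agree a n hc.
by have [b [Kb ab]] := ha m; exists (h b); split=> //; apply: hm.
Qed.

Lemma closedN_eq h k : contN h -> contN k -> closedN [set a | h a = k a].
Proof.
move=> hh hk a ha; apply: funext => n.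
have [m1 h1] := hh a n; have [m2 h2] := hk a n.
have [b [/= e ab]] := ha (maxn m1 m2).
rewrite (h1 b) ?(h2 b) ?e //; apply: agreeW ab; [exact: leq_maxr|exact: leq_maxl].
Qed.

Lemma closedN_coord i (P : nat -> Prop) : closedN [set a | P (a i)].
Proof. by move=> a /(_ i.+1) [b [/= Pb ab]]; rewrite ab. Qed.

Lemma borelN_sigma : sigma_algebra setT borelN.
Proof. exact: smallest_sigma_algebra. Qed.

Lemma borelN_eq i j : borelN [set a | a i = j].
Proof. by apply: sub_sigma_algebra; exists i, j. Qed.

Lemma borelN_coord i (P : nat -> Prop) : borelN [set a | P (a i)].
Proof.
have -> : [set a : baire | P (a i)] = [set a | exists j, P j /\ a i = j].
  by apply/seteqP; split => a /= => [?|[j [? ->]]] //; exists (a i).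
apply: (sigma_ex borelN_sigma) => j; apply: (sigma_and borelN_sigma).
  exact: (sigma_cst borelN_sigma).
exact: borelN_eq.
Qed.

Lemma borelN_ind (G : set (set baire)) : sigma_algebra setT G ->
  (forall i j, G [set a | a i = j]) -> borelN `<=` G.
Proof. by move=> hG hc; apply: smallest_sub => // _ [i [j ->]]. Qed.

Section BorelIntoBaire.
Variables (T : Type) (S : set (set T)) (e : T -> baire).
Hypotheses (hS : sigma_algebra setT S) (he : forall i j, S [set x | e x i = j]).

Lemma borelN_preimage B : borelN B -> S [set x | B (e x)].
Proof.
move: B; apply: (@borelN_ind [set B | S [set x | B (e x)]]); last exact: he.
split => /=.
- exact: (sigma_cst hS False).
- move=> A hA; apply: (sigma_and hS); first exact: (sigma_cst hS True).
  exact: (sigma_not hS).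
- move=> A hA; rewrite [X in S X](_ : _ = [set x | exists n, A n (e x)]).
    exact: (sigma_ex hS).
  by apply/seteqP; split => x /= [n] => [_ ?|?]; exists n.
Qed.

End BorelIntoBaire.

(** An open set is the union of the countably many cylinders inside it: here [s] ranges over the
    finite sequences that already force the value [j]. *)
Lemma contN_borel h : contN h -> forall i j, borelN [set a | h a i = j].
Proof.
move=> hc i j.
have -> : [set a | h a i = j] =
  [set a | exists s : seq nat, (forall b, agree (size s) (nth 0%N s) b -> h b i = j)
     /\ forall k : nat, (k < size s)%N -> nth 0%N s k = a k].
  apply/seteqP; split => a /=.
  - move=> e; have [m hm] := hc a i; exists (mkseq a m); rewrite size_mkseq; split.
      by move=> b hb; rewrite -(hm b) // => k km; rewrite -hb // nth_mkseq.
    by move=> k km; rewrite nth_mkseq.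
  - by case=> s [h1 h2]; apply: h1.
apply: (sigma_ex borelN_sigma) => s; apply: (sigma_and borelN_sigma).
  exact: (sigma_cst borelN_sigma).
apply: (sigma_all borelN_sigma) => k; apply: (sigma_imp borelN_sigma).
  exact: (sigma_cst borelN_sigma).
exact: (borelN_coord k (fun v => nth 0%N s k = v)).
Qed.

(** One point of [baire] is read as a sequence of points, along codes of pairs. This replaces
    products of copies of the Baire space. *)
Definition sec (i : nat) (a : baire) : baire := fun j => a (pickle (i, j)).

Definition join (F : nat -> baire) : baire := fun n =>
  if (pickle_inv n : option (nat * nat)) is Some ij then F ij.1 ij.2 else 0%N.

(* The image of [join]: not every natural number is the code of a pair. *)
Definition joined (a : baire) :=
  forall n, (pickle_inv n : option (nat * nat)) = None -> a n = 0%N.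

Lemma sec_join i F : sec i (join F) = F i.
Proof. by apply: funext => j; rewrite /sec /join pickleK_inv. Qed.

Lemma joined_join F : joined (join F).
Proof. by move=> n h; rewrite /join h. Qed.

Lemma joined_inj a b : joined a -> joined b -> (forall i, sec i a = sec i b) -> a = b.
Proof.
move=> ha hb hab; apply: funext => n.
case e : (pickle_inv n : option (nat * nat)) => [[i j]|]; last by rewrite ha ?hb.
have := @pickle_invK (nat * nat)%type n; rewrite /oapp e => <-.
by have := congr1 (fun f => f j) (hab i).
Qed.

Lemma closedN_joined : closedN joined.
Proof.
apply: closedN_all => n a ha hn.
by have := @closedN_coord n (fun v => v = 0%N) a; apply => m;
  have [b [hb ?]] := ha m; exists b; split => //=; apply: hb.
Qed.

Lemma contN_sec i : contN (sec i).
Proof. by move=> a j; exists (pickle (i, j)).+1 => b ab; rewrite /sec ab. Qed.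

Definition scons i (a : baire) : baire := fun n => if n is m.+1 then a m else i.
Definition shift (a : baire) : baire := fun n => a n.+1.

(** The head of [z] selects a member of the family and the tail is its argument: a coding of
    countable disjoint unions. *)
Lemma contN_family (hs : nat -> baire -> baire) : (forall i, contN (hs i)) ->
  contN (fun z => hs (z 0%N) (shift z)).
Proof.
move=> hc z n; have [m hm] := hc (z 0%N) (shift z) n; exists m.+1 => b zb.
by rewrite -(zb 0%N) //; apply: hm => i im; apply: zb.
Qed.

Lemma closedN_family (Ks : nat -> set baire) : (forall i, closedN (Ks i)) ->
  closedN [set z | Ks (z 0%N) (shift z)].
Proof.
move=> hK z hz; apply: hK => n; have [b [/= Kb zb]] := hz n.+1.
exists (shift b); rewrite (zb 0%N) //; split => // i im; exact: zb.
Qed.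

(** * Analytic sets *)

(** Closed domains, rather than the whole Baire space, cover the empty set and turn countable
    intersections into a closed condition on sequences of parameters. *)
Definition ana (A : set baire) :=
  exists K h, [/\ closedN K, contN h & A = h @` K].

Definition inj_ana (A : set baire) :=
  exists K h, [/\ closedN K, contN h, inj_on K h & A = h @` K].

Lemma inj_ana_ana A : inj_ana A -> ana A.
Proof. by case=> K [h [? ? _ ?]]; exists K, h. Qed.

Lemma closedN_inj_ana K : closedN K -> inj_ana K.
Proof.
by move=> hK; exists K, id; split => //; [exact: contN_id|rewrite image_id].
Qed.

Lemma ana_image h A : contN h -> ana A -> ana (h @` A).
Proof.
move=> hh [K [k [hK hk ->]]]; exists K, (h \o k); split => //.
  exact: contN_comp.
by rewrite image_comp.
Qed.

Section CountableOperations.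
Variables (Ks : nat -> set baire) (hs : nat -> baire -> baire).
Hypotheses (hK : forall i, closedN (Ks i)) (hh : forall i, contN (hs i)).

(** The countable fibre product of the maps [hs i]: sequences of parameters with a common value. The
    condition [joined] gives each such sequence a single code, so injectivity survives. *)
Let capK := [set z | joined z /\ forall i, Ks i (sec i z) /\
                       hs i (sec i z) = hs 0%N (sec 0%N z)].

Let closed_capK : closedN capK.
Proof.
apply: closedN_and; first exact: closedN_joined.
apply: closedN_all => i; apply: closedN_and.
  exact: closedN_preimage (contN_sec i) (@hK i).
by apply: closedN_eq; apply: contN_comp => //; exact: contN_sec.
Qed.

Let image_capK : [set a | forall i, (hs i @` Ks i) a] = (hs 0%N \o sec 0%N) @` capK.
Proof.
apply/seteqP; split => a /=.
- move=> ha; have /ex_choice[F hF] : forall i, exists b, Ks i b /\ hs i b = a.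
    by move=> i; have [b ? ?] := ha i; exists b.
  exists (join F); last by rewrite /= sec_join; case: (hF 0%N).
  split; first exact: joined_join.
  by move=> i; rewrite !sec_join; have [? ->] := hF i; have [_ ->] := hF 0%N.
- case=> z [_ hz] <- i; have [Kz ez] := hz i.
  by exists (sec i z).
Qed.

Lemma ana_cap_images : ana [set a | forall i, (hs i @` Ks i) a].
Proof.
by exists capK, (hs 0%N \o sec 0%N); split => //; apply: contN_comp => //; exact: contN_sec.
Qed.

Lemma inj_ana_cap_images : (forall i, inj_on (Ks i) (hs i)) ->
  inj_ana [set a | forall i, (hs i @` Ks i) a].
Proof.
move=> hi; exists capK, (hs 0%N \o sec 0%N); split => //.
  by apply: contN_comp => //; exact: contN_sec.
move=> a b [ja ha] [jb hb] /= e; apply: joined_inj => // i.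
have [Ka ea] := ha i; have [Kb eb] := hb i.
by apply: (hi i) => //; rewrite ea eb.
Qed.

Let image_cup : [set a | exists i, (hs i @` Ks i) a] =
  (fun z => hs (z 0%N) (shift z)) @` [set z | Ks (z 0%N) (shift z)].
Proof.
apply/seteqP; split => a /=.
- by case=> i [b Kb <-]; exists (scons i b).
- by case=> z Kz <-; exists (z 0%N), (shift z).
Qed.

Lemma ana_cup_images : ana [set a | exists i, (hs i @` Ks i) a].
Proof.
exists [set z | Ks (z 0%N) (shift z)], (fun z => hs (z 0%N) (shift z)).
by split => //; [exact: closedN_family|exact: contN_family].
Qed.

Lemma inj_ana_cup_images : (forall i, inj_on (Ks i) (hs i)) ->
  (forall i j a b, Ks i a -> Ks j b -> hs i a = hs j b -> i = j) ->
  inj_ana [set a | exists i, (hs i @` Ks i) a].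
Proof.
move=> hi hd.
exists [set z | Ks (z 0%N) (shift z)], (fun z => hs (z 0%N) (shift z)).
split => //; [exact: closedN_family|exact: contN_family|].
move=> a b /= Ka Kb e.
have e0 := hd _ _ _ _ Ka Kb e; rewrite -e0 in Kb e.
have es := hi _ _ _ Ka Kb e.
by apply: funext => -[//|n]; have := congr1 (fun f => f n) es.
Qed.

End CountableOperations.

Lemma ana_all (A : nat -> baire -> Prop) : (forall i, ana [set a | A i a]) ->
  ana [set a | forall i, A i a].
Proof.
move=> /ex_choice[Ks] /ex_choice[hs] h.
have -> : [set a | forall i, A i a] = [set a | forall i, (hs i @` Ks i) a].
  by apply/seteqP; split => a /= ha i; have := ha i; have [_ _ e] := h i;
    rewrite -[A i a]/([set a | A i a] a) e.
by apply: ana_cap_images => i; have [] := h i.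
Qed.

Lemma ana_ex (A : nat -> baire -> Prop) : (forall i, ana [set a | A i a]) ->
  ana [set a | exists i, A i a].
Proof.
move=> /ex_choice[Ks] /ex_choice[hs] h.
have -> : [set a | exists i, A i a] = [set a | exists i, (hs i @` Ks i) a].
  by apply/seteqP; split => a /= [i ha]; exists i; have := ha; have [_ _ e] := h i;
    rewrite -[A i a]/([set a | A i a] a) e.
by apply: ana_cup_images => i; have [] := h i.
Qed.

Lemma inj_ana_all (A : nat -> baire -> Prop) : (forall i, inj_ana [set a | A i a]) ->
  inj_ana [set a | forall i, A i a].
Proof.
move=> /ex_choice[Ks] /ex_choice[hs] h.
have -> : [set a | forall i, A i a] = [set a | forall i, (hs i @` Ks i) a].
  by apply/seteqP; split => a /= ha i; have := ha i; have [_ _ _ e] := h i;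
    rewrite -[A i a]/([set a | A i a] a) e.
by apply: inj_ana_cap_images => i; have [] := h i.
Qed.

Lemma inj_ana_ex (A : nat -> baire -> Prop) : (forall i, inj_ana [set a | A i a]) ->
  (forall i j a, A i a -> A j a -> i = j) -> inj_ana [set a | exists i, A i a].
Proof.
move=> /ex_choice[Ks] /ex_choice[hs] h hd.
have hA i a : A i a <-> (hs i @` Ks i) a.
  by have [_ _ _ e] := h i; rewrite -[A i a]/([set a | A i a] a) e.
have -> : [set a | exists i, A i a] = [set a | exists i, (hs i @` Ks i) a].
  by apply/seteqP; split => a /= [i /hA ha]; exists i.
apply: inj_ana_cup_images => [i|i|i|i j a b Ka Kb e]; try by have [] := h i.
by apply: (hd i j (hs i a)); apply/hA; [exists a|exists b].
Qed.

Lemma ana_and (A B : baire -> Prop) :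
  ana [set a | A a] -> ana [set a | B a] -> ana [set a | A a /\ B a].
Proof.
move=> hA hB.
rewrite (_ : [set a | _] = [set a | forall i, if i is 0%N then A a else B a]).
  by apply: ana_all => -[].
by apply/seteqP; split => a /= => [[? ?] []//|h]; split; [exact: (h 0%N)|exact: (h 1%N)].
Qed.

Lemma inj_ana_and (A B : baire -> Prop) :
  inj_ana [set a | A a] -> inj_ana [set a | B a] -> inj_ana [set a | A a /\ B a].
Proof.
move=> hA hB.
rewrite (_ : [set a | _] = [set a | forall i, if i is 0%N then A a else B a]).
  by apply: inj_ana_all => -[].
by apply/seteqP; split => a /= => [[? ?] []//|h]; split; [exact: (h 0%N)|exact: (h 1%N)].
Qed.

Lemma closedN_ana K : closedN K -> ana K.
Proof. by move=> /closedN_inj_ana/inj_ana_ana. Qed.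

(** The preimage is the projection of a fibre product: pairs of a point and a parameter with the
    same image. *)
Lemma ana_preimage h A : contN h -> ana A -> ana [set a | A (h a)].
Proof.
move=> hh [K [k [hK hk ->]]].
exists [set z | K (sec 1 z) /\ k (sec 1 z) = h (sec 0%N z)], (sec 0%N); split.
- apply: closedN_and; first exact: closedN_preimage (contN_sec 1) hK.
  by apply: closedN_eq; apply: contN_comp => //; exact: contN_sec.
- exact: contN_sec.
- apply/seteqP; split => a /=.
  + case=> b Kb e; exists (join (fun i => if i is 0%N then a else b)); rewrite !sec_join //.
  + by case=> z [Kz ez] <-; exists (sec 1 z).
Qed.

(* Both [A] and its complement are tracked so that the class is closed under
   countable unions, which are made disjoint with the complements. *)
Lemma borelN_inj_ana B : borelN B -> inj_ana B.
Proof.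
move=> hB; suff [] : inj_ana B /\ inj_ana (~` B) by [].
move: B hB; apply: (@borelN_ind [set B | inj_ana B /\ inj_ana (~` B)]); last first.
  move=> i j; split; apply: closedN_inj_ana.
    exact: (@closedN_coord i (fun v => v = j)).
  exact: (@closedN_coord i (fun v => v <> j)).
split => /=.
- split; apply: closedN_inj_ana; last by rewrite setC0.
  by move=> a /(_ 0%N) [? []].
- by move=> A [h1 h2]; rewrite !setTD setCK.
- move=> A hA; split; last first.
    rewrite setC_bigcup (_ : \bigcap_ _ _ = [set a | forall i, (~` A i) a]).
      by apply: inj_ana_all => i; have [] := hA i.
    by apply/seteqP; split => a /= h i; [apply: h|move=> _; apply: h].
  rewrite (_ : \bigcup_ _ _ = [set a | exists i, A i a /\
      forall j, if (j < i)%N then (~` A j) a else True]).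
    apply: inj_ana_ex.
      move=> i; apply: inj_ana_and; first by have [] := hA i.
      apply: inj_ana_all => j; case: (j < i)%N; first by have [] := hA j.
      by apply: closedN_inj_ana.
    move=> i j a [Ai hi] [Aj hj]; case: (ltngtP i j) => // [ij|ji].
      by have := hj i; rewrite ij.
    by have := hi j; rewrite ji.
  apply/seteqP; split => a /=; last by case=> i [? _]; exists i.
  case=> i _ Ai; have ex : exists i, `[< A i a >] by exists i; apply/asboolP.
  have [m /asboolP Am hm] := ex_minnP ex; exists m; split => // j.
  by case: ifP => // jm Aj; have /hm := asboolT Aj; rewrite leqNgt jm.
Qed.

Lemma borelN_ana B : borelN B -> ana B.
Proof. by move=> /borelN_inj_ana/inj_ana_ana. Qed.

(** * Separation *)

Definition cyl (s : seq nat) : set baire :=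
  [set a | forall i, (i < size s)%N -> a i = nth 0%N s i].

Lemma cyl_mkseq a n b : cyl (mkseq a n) b <-> agree n b a.
Proof.
by split => h i; [move=> im; rewrite h ?size_mkseq // nth_mkseq|
  rewrite size_mkseq => im; rewrite h // nth_mkseq].
Qed.

Lemma nth_prefix (s t : seq nat) i : prefix s t -> (i < size s)%N ->
  nth 0%N t i = nth 0%N s i.
Proof. by move=> /prefixP[u ->] h; rewrite nth_cat h. Qed.

Lemma cyl_prefix s t : prefix s t -> cyl t `<=` cyl s.
Proof.
move=> st a at_ i im; rewrite at_ ?(nth_prefix st) //.
by apply: leq_trans im (size_prefix st).
Qed.

Lemma prefix_mkseq s a n : cyl s a -> (size s <= n)%N -> prefix s (mkseq a n).
Proof.
move=> ha sn; rewrite prefixE; apply/eqP/(@eq_from_nth _ 0%N).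
  by rewrite size_takel ?size_mkseq.
move=> i; rewrite size_takel ?size_mkseq // => im.
by rewrite nth_take // nth_mkseq ?(ha i) // (leq_trans im sn).
Qed.

Lemma closedN_cyl s : closedN (cyl s).
Proof.
apply: closedN_all => i a ha im.
by have [b [hb ab]] := ha i.+1; rewrite ab // hb.
Qed.

Section Chain.
Variable s : nat -> seq nat.
Hypotheses (ssize : forall n, (n <= size (s n))%N)
           (sprefix : forall n, prefix (s n) (s n.+1)).

(** The size hypothesis gives [s i.+1] an entry at [i], so the default of [nth] is never read. *)
Definition chain_lim : baire := fun i => nth 0%N (s i.+1) i.

Lemma chain_prefix m n : (m <= n)%N -> prefix (s m) (s n).
Proof.
move=> /subnK <-; elim: (n - m)%N => [|k ih]; first exact: prefix_refl.
exact: prefix_trans ih (sprefix _).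
Qed.

Lemma chain_limP n : cyl (s n) chain_lim.
Proof.
move=> i im; rewrite /chain_lim; case: (leqP i.+1 n) => h.
  by rewrite (nth_prefix (chain_prefix h)).
by rewrite (nth_prefix (chain_prefix (ltnW h))).
Qed.

Lemma chain_lim_closed K : closedN K ->
  (forall n, exists a, K a /\ cyl (s n) a) -> K chain_lim.
Proof.
move=> hK h; apply: hK => n; have [a [Ka ha]] := h n; exists a; split => // i im.
have im' := leq_trans im (ssize n).
by rewrite (chain_limP im') ha.
Qed.

End Chain.

Definition separated (A B : set baire) :=
  exists C, [/\ borelN C, A `<=` C & B `<=` ~` C].

(** Read contrapositively: if two countable unions cannot be separated, neither can some pair of
    their members. This drives the descent in the separation theorem. *)
Lemma separated_cup (A B : nat -> baire -> Prop) :
  (forall i j, separated [set a | A i a] [set a | B j a]) ->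
  separated [set a | exists i, A i a] [set a | exists i, B i a].
Proof.
move=> hAB.
have /ex_choice[C hC] : forall i, exists C : nat -> set baire, forall j,
    [/\ borelN (C j), [set a | A i a] `<=` C j & [set a | B j a] `<=` ~` C j].
  by move=> i; have /ex_choice[C hC] := hAB i; exists C.
exists [set a | exists i, forall j, C i j a]; split.
- apply: (sigma_ex borelN_sigma) => i; apply: (sigma_all borelN_sigma) => j.
  by have [] := hC i j.
- by move=> a [i Ai]; exists i => j; have [_ h _] := hC i j; apply: h.
- by move=> a [j Bj] [i /(_ j)]; have [_ _] := hC i j; apply.
Qed.

Lemma image_cyl_rcons K (h : baire -> baire) s :
  h @` (K `&` cyl s) = [set a | exists i, (h @` (K `&` cyl (rcons s i))) a].
Proof.
apply/seteqP; split => a /=.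
- case=> b [Kb bs] <-; exists (b (size s)), b => //; split => // i.
  rewrite size_rcons ltnS leq_eqVlt nth_rcons => /orP[/eqP->|im]; first by rewrite ltnn eqxx.
  by rewrite im bs.
- case=> i [b [Kb bs] <-]; exists b => //; split => //.
  by apply: cyl_prefix bs; exact: prefix_rcons.
Qed.

Lemma separatedS A B A' B' : A `<=` A' -> B `<=` B' -> separated A' B' -> separated A B.
Proof.
by move=> hA hB [C [? h1 h2]]; exists C; split => //; [apply: subset_trans h1|apply: subset_trans h2].
Qed.

(** If separation failed, it would fail along a descending sequence of pairs of cylinders in the
    parameter spaces. They shrink to parameters with distinct images, the sets being disjoint, and
    by continuity one coordinate separates the images of small enough cylinders. *)
Theorem lusin_separation A B : ana A -> ana B -> A `&` B = set0 -> separated A B.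
Proof.
move=> [K [h [hK hh ->]]] [L [k [hL hk ->]]] AB0.
apply: contrapT => nsep.
pose bad (st : seq nat * seq nat) :=
  ~ separated (h @` (K `&` cyl st.1)) (k @` (L `&` cyl st.2)).
have step st : exists ij : nat * nat, bad st -> bad (rcons st.1 ij.1, rcons st.2 ij.2).
  apply: contrapT => hn.
  have hst : bad st by apply: contrapT => hb; apply: hn; exists (0%N, 0%N).
  apply: hst; rewrite !image_cyl_rcons; apply: separated_cup => i j.
  by apply: contrapT => hb; apply: hn; exists (i, j).
have [nx hnx] := ex_choice step.
pose st := fix st n : seq nat * seq nat := if n is m.+1 then
  (rcons (st m).1 (nx (st m)).1, rcons (st m).2 (nx (st m)).2) else ([::], [::]).
have hbad n : bad (st n).
  elim: n => [|n ih]; last exact: hnx.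
  apply: contra_not nsep; apply: separatedS.
    by apply: image_subset => a Ka; split.
  by apply: image_subset => a Ka; split.
have sz1 n : size (st n).1 = n by elim: n => //= n ih; rewrite size_rcons ih.
have sz2 n : size (st n).2 = n by elim: n => //= n ih; rewrite size_rcons ih.
set a := chain_lim (fun n => (st n).1); set b := chain_lim (fun n => (st n).2).
have ca n : cyl (st n).1 a.
  apply: (@chain_limP (fun n => (st n).1)) => m; first by rewrite sz1.
  exact: prefix_rcons.
have cb n : cyl (st n).2 b.
  apply: (@chain_limP (fun n => (st n).2)) => m; first by rewrite sz2.
  exact: prefix_rcons.
(* A cylinder that misses [K] has empty image, which is separated from anything; so the bad
   cylinders meet [K]. *)
have Ka : K a.
  apply: (@chain_lim_closed (fun n => (st n).1) _ _ _ hK) => m; first by rewrite sz1.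
    exact: prefix_rcons.
  apply: contrapT => hn; apply: (hbad m); exists set0; split => //.
  - exact: (sigma_cst borelN_sigma False).
  - by move=> x [c Kc _]; apply: hn; exists c.
  - by move=> x _ [].
have Lb : L b.
  apply: (@chain_lim_closed (fun n => (st n).2) _ _ _ hL) => m; first by rewrite sz2.
    exact: prefix_rcons.
  apply: contrapT => hn; apply: (hbad m); exists setT; split => //.
  - exact: (sigma_cst borelN_sigma True).
  - by move=> x [c Kc _]; case: hn; exists c.
have [i hi] : exists i, h a i <> k b i.
  apply: contrapT => hn.
  have e : h a = k b.
    by apply: funext => i; apply: contrapT => hi; apply: hn; exists i.
  have : (h @` K `&` k @` L) (h a) by split; [exists a|exists b].
  by rewrite AB0.
have [m1 hm1] := hh a i; have [m2 hm2] := hk b i.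
apply: (hbad (maxn m1 m2)); exists [set c | c i = h a i]; split.
- exact: borelN_eq.
- move=> _ [c [Kc cc] <-] /=; apply/esym/hm1 => j jm.
  have jm' : (j < maxn m1 m2)%N by rewrite (leq_trans jm) ?leq_maxl.
  by rewrite (ca (maxn m1 m2)) ?cc ?sz1.
- move=> _ [c [Lc cc] <-] /=; rewrite -(hm2 c); first by move=> e; apply: hi.
  move=> j jm; have jm' : (j < maxn m1 m2)%N by rewrite (leq_trans jm) ?leq_maxr.
  by rewrite (cb (maxn m1 m2)) ?cc ?sz2.
Qed.

(** * Injective images *)

Section LusinSouslin.
Variables (K : set baire) (h : baire -> baire).
Hypotheses (hK : closedN K) (hh : contN h) (hi : inj_on K h).

Let A s := h @` (K `&` cyl s).

Let anaA s : ana (A s).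
Proof.
apply: ana_image => //; apply: closedN_ana.
by apply: closedN_and => //; exact: closedN_cyl.
Qed.

Let disjA s t : size s = size t -> s <> t -> A s `&` A t = set0.
Proof.
move=> st nst; apply/seteqP; split => // _ [[a [Ka sa] <-] [b [Kb tb] e]].
have eab := hi Kb Ka e; subst b; case: nst.
apply: (@eq_from_nth _ 0%N) => // i im.
by rewrite -sa // tb // -st.
Qed.

(** By injectivity the images [A s] of cylinders of one length are pairwise disjoint analytic sets.
    They are enlarged to Borel sets [D s], still disjoint for each length, that also obey every
    coordinate value constant on [A s]. A point lying in some [D s] at every length determines a
    branch, and the limit of the branch is a preimage of it. *)
Theorem lusin_souslin : borelN (h @` K).
Proof.
have bS := borelN_sigma.
have /ex_choice[C hC] : forall st : seq nat * seq nat, exists C,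
    borelN C /\ (size st.1 = size st.2 -> st.1 <> st.2 -> A st.1 `<=` C /\ A st.2 `<=` ~` C).
  move=> [s t] /=; case: (pselect (size s = size t /\ s <> t)) => [[e n]|ne]; last first.
    exists set0; split; first exact: (sigma_cst bS False).
    by move=> e n; case: ne.
  by have [C [? ? ?]] := lusin_separation (anaA s) (anaA t) (disjA e n); exists C.
pose D s a := (forall t, size s = size t -> s <> t -> C (s, t) a /\ ~ C (t, s) a) /\
  forall i j, (forall b, K b -> cyl s b -> h b i = j) -> a i = j.
have bD s : borelN [set a | D s a].
  apply: (sigma_and bS).
    apply: (sigma_all bS) => t.
    apply: (sigma_imp bS); first exact: (sigma_cst bS).
    apply: (sigma_imp bS); first exact: (sigma_cst bS).
    apply: (sigma_and bS); first by have [] := hC (s, t).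
    by apply: (sigma_not bS); have [] := hC (t, s).
  apply: (sigma_all bS) => i; apply: (sigma_all bS) => j.
  apply: (sigma_imp bS); first exact: (sigma_cst bS).
  exact: borelN_eq.
have AD s a : A s a -> D s a.
  move=> Aa; split.
    move=> t st nst; split; first by have [_ /(_ st nst)[h1 _]] := hC (s, t); apply: h1.
    by have [_ /(_ (esym st) (fun e => nst (esym e)))[_ h2]] := hC (t, s); apply: h2.
  by move=> i j; case: Aa => b [Kb sb] <-; apply.
have DD s t a : size s = size t -> D s a -> D t a -> s = t.
  move=> st [Ds _] [Dt _]; apply: contrapT => nst.
  have [h1 _] := Ds t st nst.
  by have [_] := Dt s (esym st) (fun e => nst (esym e)).
(* Asking for [D] at all prefixes of [s] forces, by disjointness, the sequences found at successive
   lengths to extend one another. *)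
have -> : h @` K = [set a | forall n, exists s,
    size s = n /\ forall k, D (take k s) a].
  apply/seteqP; split => a /=.
    case=> b Kb <- n; exists (mkseq b n); rewrite size_mkseq; split => // k.
    apply: AD; exists b => //; split => //.
    by apply: (@cyl_prefix _ (mkseq b n)); [exact: prefix_take|exact/cyl_mkseq].
  move=> /ex_choice[s hs].
  have sz n : size (s n) = n by have [] := hs n.
  have Ds n : D (s n) a.
    by have [_ /(_ n)] := hs n; rewrite take_oversize ?sz.
  have spre n : prefix (s n) (s n.+1).
    rewrite prefixE sz; apply/eqP/(DD _ _ a) => //; first by rewrite size_takel ?sz.
    by have [_] := hs n.+1; apply.
  have ssz n : (n <= size (s n))%N by rewrite sz.
  have Kl : K (chain_lim s).
    apply: chain_lim_closed => // n; apply: contrapT => hn.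
    have [_ hD] := Ds n.
    (* If the cylinder misses [K], the clause on constant values applies vacuously to two different
       values. *)
    have h0 : a 0%N = 0%N by apply: hD => b Kb sb; case: hn; exists b.
    have h1 : a 0%N = 1%N by apply: hD => b Kb sb; case: hn; exists b.
    by rewrite h0 in h1.
  exists (chain_lim s) => //; apply: funext => i.
  have [m hm] := hh (chain_lim s) i.
  have [_ hD] := Ds m; apply/esym/hD => b Kb sb; apply/esym/hm => j jm.
  by rewrite (chain_limP ssz spre (n:=m)) ?sz // sb ?sz.
apply: (sigma_all bS) => n; apply: (sigma_ex bS) => s; apply: (sigma_and bS).
  exact: (sigma_cst bS).
by apply: (sigma_all bS) => k; apply: bD.
Qed.

End LusinSouslin.

(** * Cantor schemes *)

(** The diagonal argument, evaluated at the code of the diagonal sequence [d] itself. *)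
Lemma bool_seq_uncountable (g : (nat -> bool) -> nat) : ~ injective g.
Proof.
move=> gi; pose d n := `[< exists d', g d' = n /\ d' n = false >].
case e : (d (g d)).
  by have /asboolP[d' [/gi ->]] := e; rewrite e.
have : d (g d) by apply/asboolP; exists d.
by rewrite e.
Qed.

Section CantorScheme.
Variables (K : set baire) (h : baire -> baire) (t : seq bool -> seq nat).
Hypotheses (hK : closedN K)
  (t_ext : forall b l, prefix (t l) (t (b :: l)) /\ (size (t l) < size (t (b :: l)))%N)
  (t_sep : forall l, exists i j, (forall a, K a -> cyl (t (true :: l)) a -> h a i = j) /\
     (forall a, K a -> cyl (t (false :: l)) a -> h a i <> j))
  (t_ne : forall l, exists a, K a /\ cyl (t l) a).

(** The most recent bit comes first, so that the children of a node [l] are the [b :: l]. *)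
Fixpoint branch (d : nat -> bool) n := if n is m.+1 then d m :: branch d m else [::].

Definition scheme_lim (d : nat -> bool) : baire := chain_lim (fun n => t (branch d n)).

Lemma scheme_size d n : (n <= size (t (branch d n)))%N.
Proof.
elim: n => //= n ih; have [_] := t_ext (d n) (branch d n).
by move=> h'; apply: leq_ltn_trans ih h'.
Qed.

Lemma scheme_prefix d n : prefix (t (branch d n)) (t (branch d n.+1)).
Proof. by have [] := t_ext (d n) (branch d n). Qed.

Lemma scheme_limP d n : cyl (t (branch d n)) (scheme_lim d).
Proof. exact: (@chain_limP (fun n => t (branch d n)) (scheme_size d) (scheme_prefix d)). Qed.

Lemma scheme_lim_mem d : K (scheme_lim d).
Proof.
exact: (@chain_lim_closed (fun n => t (branch d n)) (scheme_size d) (scheme_prefix d)).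
Qed.

Lemma scheme_lim_inj d d' : h (scheme_lim d) = h (scheme_lim d') -> d = d'.
Proof.
move=> e; have hb n : branch d n = branch d' n.
  elim: n => //= n ih; rewrite ih; congr cons.
  have [i [j [ht hf]]] := t_sep (branch d n).
  have cd := @scheme_limP d n.+1; have cd' := @scheme_limP d' n.+1.
  have Kd := scheme_lim_mem d; have Kd' := scheme_lim_mem d'.
  move: cd cd' => /=; rewrite -ih.
  case: (d n); case: (d' n) => // c c'.
  - by case: (hf _ Kd' c'); rewrite -e; apply: ht.
  - by case: (hf _ Kd c); rewrite e; apply: ht.
by apply: funext => n; have [] := hb n.+1.
Qed.

Lemma scheme_lim_branch d d' n i : (i < n)%N -> (forall k, (k < n)%N -> d k = d' k) ->
  scheme_lim d i = scheme_lim d' i.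
Proof.
move=> im hd; have hb : branch d n = branch d' n.
  by elim: n hd {im} => //= n ih hd; rewrite hd // ih // => k kn; apply: hd; apply: ltnW.
have im' : (i < size (t (branch d n)))%N := leq_trans im (scheme_size d n).
rewrite (scheme_limP im') hb (scheme_limP (d:=d') (n:=n)) // -hb //.
Qed.

End CantorScheme.

Lemma uncountable_remainder (T : Type) (P Q : set T) (A : set T) :
  countable P -> A `<=` P `|` Q -> ~ countable A -> ~ countable Q.
Proof.
move=> cP sA nA cQ; apply: nA.
apply: sub_countable (_ : countable (P `|` Q)); first exact: subset_card_le.
rewrite (_ : P `|` Q = \bigcup_(b in [set: bool]) if b then P else Q).
  by apply: bigcup_countable => //= -[].
apply/seteqP; split => x /=; first by case=> ?; [exists true|exists false].
by case=> -[] _ ?; [left|right].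
Qed.

Definition binary (a : baire) := forall n, (a n <= 1)%N.

(* In an uncountable analytic set [h @` K], deleting the countably many cylinders
   whose image is countable leaves uncountably many points, any two of which
   can be separated: this yields the splitting step of the scheme. *)
Theorem perfect_set A : ana A -> ~ countable A ->
  exists phi, [/\ contN phi, forall z, A (phi z) &
    forall z z', binary z -> binary z' -> phi z = phi z' -> z = z'].
Proof.
move=> [K [h [hK hh ->]]] hA.
pose big s := ~ countable (h @` (K `&` cyl s)).
have step s : exists uv : seq nat * seq nat, big s -> [/\ big uv.1, big uv.2,
    prefix s uv.1 /\ (size s < size uv.1)%N, prefix s uv.2 /\ (size s < size uv.2)%N &
    exists i j, (forall a, K a -> cyl uv.1 a -> h a i = j) /\
      (forall a, K a -> cyl uv.2 a -> h a i <> j)].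
  case: (pselect (big s)) => [bs|nbs]; last by exists ([::], [::]) => /nbs.
  pose P := \bigcup_(u in [set u | ~ big u]) (h @` (K `&` cyl u)).
  have cP : countable P.
    apply: bigcup_countable; first exact: countableP.
    by move=> u; apply: contrapT.
  pose Q := h @` [set a | K a /\ cyl s a /\ forall n, big (mkseq a n)].
  have nQ : ~ countable Q.
    apply: (uncountable_remainder cP _ bs) => _ [a [Ka sa] <-].
    case: (pselect (forall n, big (mkseq a n))) => hn; first by right; exists a.
    left; have [n hn'] : exists n, ~ big (mkseq a n) by apply/existsNP.
    by exists (mkseq a n) => //; exists a => //; split => //; exact/cyl_mkseq.
  have [a [b [[Ka [sa Ba]] [Kb [sb Bb]] nab]]] : exists a b, [/\
      (K a /\ cyl s a /\ forall n, big (mkseq a n)),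
      (K b /\ cyl s b /\ forall n, big (mkseq b n)) & h a <> h b].
    apply: contrapT => hn; apply: nQ.
    case: (pselect (exists a, Q a)) => [[c [a ha ea]]|hQ].
      apply: sub_countable (countable1 c); apply: subset_card_le => _ [b hb <-] /=.
      by apply: contrapT => ne; apply: hn; exists b, a; rewrite ea.
    rewrite (_ : Q = set0); first exact: countable0.
    by apply/seteqP; split => // c Qc; case: hQ; exists c.
  have [i hi] : exists i, h a i <> h b i.
    apply/existsNP => hi; apply: nab; exact: funext.
  have [m hm] := hh a i; have [m' hm'] := hh b i.
  pose n := maxn (maxn m m') (size s).+1.
  have [mn m'n sn] : [/\ m <= n, m' <= n & size s < n]%N by rewrite /n; split; lia.
  exists (mkseq a n, mkseq b n) => _ /=; split => //.
  - by rewrite size_mkseq; split => //; apply: prefix_mkseq => //; apply: ltnW.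
  - by rewrite size_mkseq; split => //; apply: prefix_mkseq => //; apply: ltnW.
  - exists i, (h a i); split => c Kc /cyl_mkseq hc.
      by apply/esym/hm/agree_sym/(agreeW mn).
    by rewrite -(hm' c) //; [move=> e; apply: hi|apply/agree_sym/(agreeW m'n)].
have [sp hsp] := ex_choice step.
pose t := fix t l := if l is b :: l' then
   (if b then (sp (t l')).1 else (sp (t l')).2) else [::].
have bt l : big (t l).
  elim: l => [|b l ih]; last by have [] := hsp _ ih; case: b.
  apply: contra_not hA; rewrite (_ : K `&` cyl [::] = K) //.
  by apply/seteqP; split => // a [].
have t_ext b l : prefix (t l) (t (b :: l)) /\ (size (t l) < size (t (b :: l)))%N.
  by have [] := hsp _ (bt l); case: b.
have t_sep l : exists i j, (forall a, K a -> cyl (t (true :: l)) a -> h a i = j) /\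
     (forall a, K a -> cyl (t (false :: l)) a -> h a i <> j).
  by have [] := hsp _ (bt l).
have t_ne l : exists a, K a /\ cyl (t l) a.
  apply: contrapT => hn; apply: (bt l).
  rewrite (_ : K `&` cyl (t l) = set0) ?image_set0; first exact: countable0.
  by apply/seteqP; split => // a ?; case: hn; exists a.
(* The map has to be continuous on all of [baire]; reading a bit as [z n == 1] loses nothing on
   binary sequences. *)
exists (fun z => h (scheme_lim t (fun n => z n == 1%N))); split.
- apply: (contN_comp hh) => z i; exists i.+1 => z' zz'.
  by apply: (scheme_lim_branch t_ext (ltnSn i)) => k ki; rewrite zz'.
- move=> z; exists (scheme_lim t (fun n => z n == 1%N)) => //.
  exact: scheme_lim_mem.
- move=> z z' bz bz' /(scheme_lim_inj hK t_ext t_sep t_ne) e; apply: funext => n.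
  have := congr1 (fun f => f n) e; have := bz n; have := bz' n.
  by case: (z n) (z' n) => [|[]] // [|[]].
Qed.

(** * Countable-to-one maps *)

Lemma closedN_neq h k i : contN h -> contN k -> closedN [set a | h a i <> k a i].
Proof.
move=> hh hk a ha; have [m1 h1] := hh a i; have [m2 h2] := hk a i.
have [b [/= e ab]] := ha (maxn m1 m2).
rewrite (h1 b) ?(h2 b) //; apply: agreeW ab; [exact: leq_maxr|exact: leq_maxl].
Qed.

Lemma exists_neq (a b : baire) : a <> b -> exists i, a i <> b i.
Proof. by move=> ab; apply/existsNP => h; apply: ab; exact: funext. Qed.

Fixpoint node (l : seq bool) : nat :=
  if l is b :: l' then ((node l').*2 + if b then 1 else 2)%N else 0%N.

Lemma node_branch_ge d r : (r <= node (branch d r))%N.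
Proof. by elim: r => //= r ih; case: (d r); lia. Qed.

(** When nodes are split in order, the leaves after [n] splits are [n .. 2n], and every branch meets
    them: the first node on it numbered at least [n] has its parent below [n], hence is at most
    [2n]. The hypothesis on [m] places the meeting point at depth at least [m]. *)
Lemma node_branch_meets d n m : (node (branch d m) <= n)%N ->
  exists r, [/\ m <= r, n <= node (branch d r) & node (branch d r) <= n.*2]%N.
Proof.
move=> hm.
have ex : exists r, (m <= r)%N && (n <= node (branch d r))%N.
  exists (maxn m n); have := node_branch_ge d (maxn m n); lia.
have [r /andP[mr nr] rmin] := ex_minnP ex; exists r; split => //.
case: (leqP r m) => rm.
  by have e : r = m by [lia]; rewrite e in nr *; lia.
case: r => // r in mr nr rmin rm *.
have h : (node (branch d r) < n)%N.
  rewrite ltnNge; apply/negP => h; have := rmin r; rewrite h -ltnS rm => /(_ isT); lia.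
by move=> /=; case: (d r); lia.
Qed.

Section LusinNovikov.
Variables (K : set baire) (p q : baire -> baire).
Hypotheses (hK : closedN K) (hp : contN p) (hq : contN q)
  (pq : forall a b, K a -> K b -> p a = p b -> q a = q b)
  (cnt : forall a, K a -> countable (p @` [set b | K b /\ q b = q a])).

(** By [pq] the map [q] factors through [p]; this says that [A] is a partial section of the factor
    map, with at most one value of [p] over each value of [q]. *)
Definition fiber_inj (A : set baire) :=
  forall a b, K a -> K b -> A (p a) -> A (p b) -> q a = q b -> p a = p b.

(** The points sharing a fibre with a different point of [A]; thus [A] is a partial section exactly
    when it misses [sat A]. *)
Let sat (A : set baire) :=
  p @` [set b | K b /\ exists a, [/\ K a, A (p a), q a = q b & p a <> p b]].

Let ana_sat A : ana A -> ana (sat A).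
Proof.
move=> hA.
have -> : sat A = (p \o sec 1) @` [set z | K (sec 0%N z) /\ (K (sec 1%N z) /\
   (A (p (sec 0%N z)) /\ (q (sec 0%N z) = q (sec 1%N z) /\
    exists i, p (sec 0%N z) i <> p (sec 1%N z) i)))].
  apply/seteqP; split => y /=.
  - case=> b [Kb [a [Ka Aa qab pab]]] <-.
    exists (join (fun i => if i is 0%N then a else b)); rewrite /= !sec_join //.
    by do 4!split => //; exact: exists_neq.
  - case=> z [Kz [Kz' [Az [qz [i pz]]]]] <-; exists (sec 1 z) => //; split => //.
    by exists (sec 0%N z); split => // e; apply: pz; rewrite e.
have cs i := contN_sec i.
apply: ana_image; first exact: contN_comp.
apply: ana_and; first by apply/closedN_ana/(closedN_preimage (cs 0%N)).
apply: ana_and; first by apply/closedN_ana/(closedN_preimage (cs 1%N)).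
apply: ana_and; first exact: (ana_preimage (contN_comp hp (cs 0%N)) hA).
apply: ana_and; first exact/closedN_ana/(closedN_eq (contN_comp hq (cs 0%N)) (contN_comp hq (cs 1%N))).
apply: ana_ex => i; apply/closedN_ana.
exact: (@closedN_neq _ _ i (contN_comp hp (cs 0%N)) (contN_comp hp (cs 1%N))).
Qed.

(* Separate [A] from [sat A] by [C], then [A] from [sat C] by [D]: the
   intersection of [C] and [D] is as required. *)
Let fiber_inj_borel A : ana A -> fiber_inj A ->
  exists B, [/\ borelN B, A `<=` B & fiber_inj B].
Proof.
move=> hA iA.
have [C [bC AC CA]] : separated A (sat A).
  apply: lusin_separation => //; first exact: ana_sat.
  apply/seteqP; split => // y [Ay [b [Kb [a [Ka Aa qab pab]]] e]].
  by apply: pab; apply: iA => //; rewrite e.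
have [D [bD AD DC]] : separated A (sat C).
  apply: lusin_separation => //; first exact/ana_sat/borelN_ana.
  apply/seteqP; split => // y [Ay [b [Kb [a [Ka Ca qab pab]]] e]].
  apply: (CA (p a)) => //; exists a => //; split => //; exists b; split => //.
    by rewrite e.
  exact: nesym.
exists (C `&` D); split.
- exact: (sigma_and borelN_sigma).
- by move=> a Aa; split; [apply: AC|apply: AD].
- move=> a b Ka Kb [Ca _] [_ Db] qab; apply: contrapT => pab.
  by apply: (DC (p b)) => //; exists b => //; split => //; exists a.
Qed.

(* A configuration assigns a finite sequence to each node [k <= 2n] of the binary
   tree in which [k] has children [2k+1] and [2k+2]; the nodes [n .. 2n] are the
   current leaves. It is realized in [B] when some fiber of [q] meets [B] in all
   leaf cylinders. *)
Let config := (seq (seq nat) * nat)%type.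

Let realized (c : config) (B : set baire) :=
  exists a, K a /\ forall k, (c.2 <= k)%N -> (k <= c.2.*2)%N ->
    exists b, [/\ K b, cyl (nth [::] c.1 k) b, B (p b) & q b = q a].

Let realizedS c B B' : B `<=` B' -> realized c B -> realized c B'.
Proof.
move=> BB' [a [Ka ha]]; exists a; split => // k k1 k2.
by have [b [? ? Bb ?]] := ha k k1 k2; exists b; split => //; apply: BB'.
Qed.

Let off (W : nat -> set baire) := [set y | forall i, ~ W i y].

Let killable c := exists W, (forall i, borelN (W i) /\ fiber_inj (W i)) /\
  ~ realized c (off W).

(** The values of [p] that can sit at the leaf [c.2], the next one to be split, when [c] is realized
    in [B]. *)
Let realization_set (c : config) (B : set baire) :=
  p @` [set a | K a /\ (cyl (nth [::] c.1 c.2) a /\ (B (p a) /\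
    forall k, (if (c.2 <= k <= c.2.*2)%N then
      exists b, [/\ K b, cyl (nth [::] c.1 k) b, B (p b) & q b = q a] else True)))].

Let ana_realization_set c B : borelN B -> ana (realization_set c B).
Proof.
move=> /borelN_ana bB; have cs i := contN_sec i.
apply: ana_image => //.
apply: ana_and; first exact: closedN_ana.
apply: ana_and; first exact/closedN_ana/closedN_cyl.
apply: ana_and; first exact: (ana_preimage hp bB).
apply: ana_all => k; case: (_ <= k <= _)%N; last exact: closedN_ana.
rewrite (_ : [set a | _] = sec 0%N @` [set z | K (sec 1%N z) /\
   (cyl (nth [::] c.1 k) (sec 1%N z) /\ (B (p (sec 1%N z)) /\ q (sec 1%N z) = q (sec 0%N z)))]).
  apply: ana_image => //.
  apply: ana_and; first by apply/closedN_ana/(closedN_preimage (cs 1%N)).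
  apply: ana_and; first by apply/closedN_ana/(closedN_preimage (cs 1%N)); exact: closedN_cyl.
  apply: ana_and; first exact: (ana_preimage (contN_comp hp (cs 1%N)) bB).
  exact/closedN_ana/(closedN_eq (contN_comp hq (cs 1%N)) (contN_comp hq (cs 0%N))).
apply/seteqP; split => a /=.
  case=> b [Kb cb Bb qb]; exists (join (fun i => if i is 0%N then a else b));
    by rewrite !sec_join.
by case=> z [Kz [cz [Bz qz]]] <-; exists (sec 1%N z).
Qed.

(** A splitting of the leaf [c.2]: both sequences properly extend it, and one coordinate of [p]
    tells them apart, as a Cantor scheme demands. *)
Let extends_to (c : config) (s0 s1 : seq nat) :=
  [/\ prefix (nth [::] c.1 c.2) s0 /\ (size (nth [::] c.1 c.2) < size s0)%N,
      prefix (nth [::] c.1 c.2) s1 /\ (size (nth [::] c.1 c.2) < size s1)%N &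
      exists i j, (forall a, K a -> cyl s0 a -> p a i = j) /\
        (forall a, K a -> cyl s1 a -> p a i <> j)].

(** When [c.1] has [2n+1] entries, with [n = c.2], the new ones land at the indices of the children
    of [n]. *)
Let extend (c : config) s0 s1 : config := (c.1 ++ [:: s0; s1], c.2.+1).

Let killable_extend (c : config) : size c.1 = (c.2.*2).+1 ->
  (forall s0 s1, extends_to c s0 s1 -> killable (extend c s0 s1)) -> killable c.
Proof.
move=> sc hext.
have /ex_choice[W hW] : forall c : config, exists W,
    (forall i, borelN (W i) /\ fiber_inj (W i)) /\ (killable c -> ~ realized c (off W)).
  move=> c'; case: (pselect (killable c')) => [[W [? ?]]|nk]; first by exists W.
  exists (fun=> set0); split => // i; split; first exact: (sigma_cst borelN_sigma False).
  by move=> ? ? ? ? [].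
(* [B] avoids the sections of all killable configurations at once; it is Borel because
   configurations are countable in number. *)
pose B := [set y | forall c i, ~ W c i y].
have bB : borelN B.
  apply: (sigma_all borelN_sigma) => c'; apply: (sigma_all borelN_sigma) => i.
  by apply: (sigma_not borelN_sigma); have [/(_ i)[]] := hW c'.
have BW c' : B `<=` off (W c') by move=> y hy i; apply: hy.
(* Two different points at the leaf over one fibre could serve as its two children and would realize
   in [B] an extension of [c], although that extension is killable. *)
have iA : fiber_inj (realization_set c B).
  move=> a0 a0' Ka0 Ka0' [a [Ka [ca [Ba ha]]] ea] [a' [Ka' [ca' [Ba' ha']]] ea'] q0.
  have qaa : q a = q a'.
    by rewrite (pq Ka Ka0 ea) q0; apply/esym/pq.
  rewrite -ea -ea'; apply: contrapT => /exists_neq[i pi].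
  have [m hm] := hp a i; have [m' hm'] := hp a' i.
  set s := nth [::] c.1 c.2 in ca ca'.
  pose n := maxn (maxn m m') (size s).+1.
  have [mn m'n sn] : [/\ m <= n, m' <= n & size s < n]%N by rewrite /n; split; lia.
  have ext : extends_to c (mkseq a n) (mkseq a' n).
    split.
    - by rewrite size_mkseq; split => //; apply: prefix_mkseq => //; apply: ltnW.
    - by rewrite size_mkseq; split => //; apply: prefix_mkseq => //; apply: ltnW.
    - exists i, (p a i); split => b Kb /cyl_mkseq hb.
        by apply/esym/hm/agree_sym/(agreeW mn).
      by rewrite -(hm' b) //; [move=> e; apply: pi|apply/agree_sym/(agreeW m'n)].
  have [_ /(_ (hext _ _ ext))] := hW (extend c (mkseq a n) (mkseq a' n)).
  apply; apply: realizedS (BW _) _; exists a; split => // k /= k1 k2.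
  rewrite nth_cat sc; case: ltnP => hk.
    by have := ha k; rewrite ifT //; lia.
  have [e|e] : (k = c.2.*2.+1 \/ k = c.2.*2.+2)%N by lia.
    by rewrite e subnn /=; exists a; split => //; exact/cyl_mkseq.
  by rewrite e subSnn /=; exists a'; split => //; exact/cyl_mkseq.
have [A' [bA' AA' iA']] := fiber_inj_borel (ana_realization_set c bB) iA.
(* The code [None] holds the new section [A']; the codes [Some (c, i)] keep all the old ones, so
   that what is left lies in [B]. *)
pose W' m := if (unpickle m : option (option (config * nat))) is Some x then
   (if x is Some ci then W ci.1 ci.2 else A') else set0.
exists W'; split.
  move=> m; rewrite /W'; case: unpickle => [[[c' i]|]|] //=.
    by have [] := hW c'.
  split; first exact: (sigma_cst borelN_sigma False).
  by move=> ? ? ? ? [].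
move=> [a [Ka ha]].
have [b [Kb cb Bb qb]] : exists b, [/\ K b, cyl (nth [::] c.1 c.2) b, off W' (p b) & q b = q a].
  by apply: ha => //; lia.
have offB : off W' `<=` B.
  move=> y hy c' i; have := hy (pickle (Some (c', i))).
  by rewrite /W' pickleK.
have := Bb (pickle (None : option (config * nat))); rewrite /W' pickleK; apply; apply: AA'.
exists b => //; split => //; split => //; split; first exact: offB.
move=> k; case: ifP => // /andP[k1 k2]; have [b' [? ? Bb' qb']] := ha k k1 k2.
by exists b'; split => //; [exact: offB|rewrite qb'].
Qed.

Let killable_root : killable ([:: [::]], 0%N).
Proof.
apply: contrapT => nroot.
(* The number [n] of splits is read off the length [2n+1] of the list. *)
pose conf c : config := (c, (size c)./2).
have /ex_choice[nx hnx] : forall c : seq (seq nat), exists s : seq nat * seq nat,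
    size c = ((size c)./2.*2).+1 -> ~ killable (conf c) ->
    extends_to (conf c) s.1 s.2 /\ ~ killable (extend (conf c) s.1 s.2).
  move=> c; apply: contrapT => hn.
  have hn' s : ~ (size c = ((size c)./2.*2).+1 -> ~ killable (conf c) ->
    extends_to (conf c) s.1 s.2 /\ ~ killable (extend (conf c) s.1 s.2)).
    by move=> hs; apply: hn; exists s.
  have [sc nk] : size c = ((size c)./2.*2).+1 /\ ~ killable (conf c).
    by split; apply: contrapT => hc; apply: (hn' ([::], [::])).
  apply: nk; apply: killable_extend => // s0 s1 ext; apply: contrapT => nk'.
  by apply: (hn' (s0, s1)).
pose cs := fix cs n := if n is m.+1 then cs m ++ [:: (nx (cs m)).1; (nx (cs m)).2]
  else [:: [::]].
have szcs n : size (cs n) = n.*2.+1.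
  by elim: n => //= n ih; rewrite size_cat ih /=; lia.
have halfcs n : (size (cs n))./2 = n by rewrite szcs; lia.
have confcs n : conf (cs n) = (cs n, n) by rewrite /conf halfcs.
have hcs n : ~ killable (cs n, n) /\ extends_to (cs n, n) (nx (cs n)).1 (nx (cs n)).2.
  elim: n => [|n [nk ext]].
    by split => //; have [] := hnx (cs 0%N); rewrite ?confcs ?halfcs ?szcs.
  have nk' : ~ killable (cs n.+1, n.+1).
    by have [] := hnx (cs n); rewrite ?confcs ?halfcs ?szcs.
  by split => //; have [] := hnx (cs n.+1); rewrite ?confcs ?halfcs ?szcs.
have hreal n : realized (cs n, n) setT.
  apply: contrapT => hn; have [nk _] := hcs n; apply: nk.
  (* With empty sections: a configuration realized nowhere is killable. *)
  exists (fun=> set0); split.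
    move=> i; split; first exact: (sigma_cst borelN_sigma False).
    by move=> ? ? ? ? [].
  by move=> hr; apply: hn; apply: realizedS hr.
(* Entries never change once appended, and stage [k] already has one at [k]; so [sg k] is the final
   label of node [k]. *)
pose sg k := nth [::] (cs k) k.
have cs_mono m d k : (k < size (cs m))%N -> nth [::] (cs (m + d)) k = nth [::] (cs m) k.
  move=> km; elim: d => [|d ih]; first by rewrite addn0.
  rewrite addnS /= nth_cat ifT ?ih //; apply: leq_trans km _; rewrite !szcs; lia.
have csE m k : (k <= m.*2)%N -> nth [::] (cs m) k = sg k.
  move=> km; rewrite /sg -(cs_mono m k k) ?szcs // addnC -(cs_mono k m k) // szcs; lia.
have sgL n : sg n.*2.+1 = (nx (cs n)).1.
  by rewrite -(csE n.+1) /= ?nth_cat ?szcs ?ltnn ?subnn //; lia.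
have sgR n : sg n.*2.+2 = (nx (cs n)).2.
  rewrite -(csE n.+1); last by lia.
  by rewrite /= nth_cat szcs ifN ?subSnn //; lia.
pose t l := sg (node l).
have tT l : t (true :: l) = (nx (cs (node l))).1 by rewrite /t /= addn1 sgL.
have tF l : t (false :: l) = (nx (cs (node l))).2 by rewrite /t /= addn2 sgR.
have tE l : nth [::] (cs (node l)) (node l) = t l by [].
have t_ext b l : prefix (t l) (t (b :: l)) /\ (size (t l) < size (t (b :: l)))%N.
  by have [_ [h1 h2 _]] := hcs (node l); case: b; rewrite ?tT ?tF.
have t_sep l : exists i j, (forall a, K a -> cyl (t (true :: l)) a -> p a i = j) /\
     (forall a, K a -> cyl (t (false :: l)) a -> p a i <> j).
  by have [_ [_ _]] := hcs (node l); rewrite tT tF.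
have t_ne l : exists a, K a /\ cyl (t l) a.
  have [a [Ka /(_ (node l) (leqnn _))]] := hreal (node l).
  by case=> [|b [Kb cb _ _]]; [rewrite /=; lia|exists b].
have Kl d : K (scheme_lim t d) by exact: scheme_lim_mem.
(* All limits lie in one fibre: a late stage is realized inside a single fibre, and both branches
   pass through its leaves at depths beyond the moduli of continuity of [q]. *)
have qE d d' : q (scheme_lim t d) = q (scheme_lim t d').
  apply: funext => i.
  have [m hm] := hq (scheme_lim t d) i; have [m' hm'] := hq (scheme_lim t d') i.
  pose n := maxn (node (branch d m)) (node (branch d' m')).
  have [r [mr nr rn]] := node_branch_meets (leq_maxl _ _ : (node (branch d m) <= n)%N).
  have [r' [mr' nr' rn']] := node_branch_meets (leq_maxr _ _ : (node (branch d' m') <= n)%N).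
  have [a [Ka ha]] := hreal n.
  have [b [Kb cb _ qb]] := ha _ nr rn; have [b' [Kb' cb' _ qb']] := ha _ nr' rn'.
  rewrite /= csE // in cb; rewrite /= csE // in cb'.
  rewrite (hm b) ?(hm' b') ?qb ?qb' // => j jm.
    have js : (j < size (t (branch d' r')))%N.
      exact: leq_trans (leq_trans jm mr') (scheme_size t_ext _ _).
    by rewrite (scheme_limP t_ext js) -cb'.
  have js : (j < size (t (branch d r)))%N.
    exact: leq_trans (leq_trans jm mr) (scheme_size t_ext _ _).
  by rewrite (scheme_limP t_ext js) -cb.
have /countable_injP[f fi] := cnt (Kl (fun=> true)).
apply: (@bool_seq_uncountable (fun d => f (p (scheme_lim t d)))) => d d' e.
apply: (scheme_lim_inj hK t_ext t_sep t_ne).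
by apply: fi => //; rewrite inE; [exists (scheme_lim t d)|exists (scheme_lim t d')].
Qed.

(** The root has a single leaf, labelled by the empty sequence, so one value of [p] escaping all the
    [W i] would realize it: killing the root means covering. *)
Theorem lusin_novikov : exists W : nat -> set baire,
  [/\ forall i, borelN (W i), forall a, K a -> exists i, W i (p a) &
      forall i, fiber_inj (W i)].
Proof.
have [W [hW nr]] := killable_root; exists W; split => [i|a Ka|i]; try by have [] := hW i.
apply: contrapT => hn; apply: nr; exists a; split => // k k1 k2.
have -> : k = 0%N by move: k1 k2 => /=; lia.
by exists a; split => // i hi; apply: hn; exists i.
Qed.

End LusinNovikov.

(** * Standard Borel spaces as Borel subsets of the Baire space *)

Section PolishCode.
Import Order.TTheory GRing.Theory Num.Theory.
Local Open Scope ring_scope.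
Variables (R : realType) (M : metricType R).
Hypothesis hM : polish M.

Let d := @mdist R M.

Let open_mdist (Ob : set M) : open Ob <->
  forall x, Ob x -> exists e, 0 < e /\ forall y, d x y < e -> Ob y.
Proof.
rewrite openE /=; split=> h x /h.
- move=> /nbhs_ballP[e e0 he]; exists e; split => // y xy; apply: he.
  by rewrite ballEmdist.
- by case=> e [e0 he]; apply/nbhs_ballP; exists e => // y; rewrite ballEmdist; apply: he.
Qed.

Let mdist_complete (u : nat -> M) :
  (forall e, 0 < e -> exists N, forall m n, (N <= m)%N -> (N <= n)%N -> d (u m) (u n) < e) ->
  exists l, forall e, 0 < e -> exists N, forall n, (N <= n)%N -> d l (u n) < e.
Proof.
case: hM => _ hc hu; have [|l hl] := hc u.
  apply/cauchy_exP => e e0; have [N hN] := hu e e0; exists (u N).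
  exists N => //= n nN /=; rewrite ballEmdist /=; exact: hN.
exists l => e e0; have := metricType_numDomainType.cvgr_dist_lt hl e0.
by case=> N _ hN; exists N => n nN; exact: hN.
Qed.

Let rad (k : nat) : R := k.+1%:R^-1.

Let rad_gt0 k : 0 < rad k. Proof. by rewrite invr_gt0 ltr0n. Qed.

Let rad_lt e : 0 < e -> exists k, rad k < e.
Proof.
by move=> e0; have [N _ hN] := near_infty_natSinv_lt (PosNum e0); exists N; have := hN N (leqnn N).
Qed.

(** Balls around the points of the dense set, numbered through an injection of that set into [nat];
    numbers that name no ball give the empty set. *)
Let mdist_base : exists Ob : nat -> set M, (forall n, open (Ob n)) /\
  forall x e, 0 < e -> exists n, Ob n x /\ forall z, Ob n z -> d x z < e.
Proof.
have [[D cD dD] _] := hM; have /countable_injP[f fi] := cD.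
pose Ob n := if (unpickle n : option (nat * nat)) is Some kr then
  [set x | exists y, [/\ D y, f y = kr.1 & d y x < rad kr.2]] else set0.
have ballo y r : open [set x | d y x < r].
  apply/open_mdist => x /= yx; exists (r - d y x); rewrite subr_gt0; split => // z xz.
  by apply: le_lt_trans (metric_triangle y x z) _; rewrite -ltrBrDl.
exists Ob; split.
  move=> n; rewrite /Ob; case: unpickle => [[k r]|]; last exact: open0.
  apply/open_mdist => x [y [Dy fy yx]] /=.
  have [e [e0 he]] := (open_mdist _).1 (ballo y (rad r)) x yx.
  by exists e; split => // z /he yz; exists y.
move=> x e e0; have [r hr] : exists k, rad k < e / 2 by apply: rad_lt; rewrite divr_gt0.
have [||y [xy Dy]] := dD [set y | d x y < rad r].
- by exists x; rewrite /= /d mdistxx.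
- exact: ballo.
exists (pickle (f y, r)); rewrite /Ob pickleK; split => /=.
  by exists y; split => //; rewrite /d metric_sym.
move=> z [y' [Dy' fy' yz]]; have ey : y' = y by apply: fi => //; rewrite inE.
rewrite ey in yz; apply: le_lt_trans (metric_triangle x y z) _.
by rewrite (splitr e); apply: ltrD; apply: lt_trans hr.
Qed.

(* A point is coded by the set of basic open sets containing it. The codes are the
   upward closed families of pairwise meeting basic sets that contain arbitrarily
   small sets and, with each set, one whose closure it contains; completeness gives
   the point. *)
Lemma polish_code : exists c : M -> baire,
  [/\ forall x, binary (c x), injective c, borelN (range c) &
      <<s @open M >> = [set c @^-1` B | B in borelN]].
Proof.
have [Ob [oO hO]] := mdist_base.
have bS := borelN_sigma.
pose c x : baire := fun n => `[< Ob n x >] : nat.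
have cE x n : c x n = 1%N <-> Ob n x.
  by rewrite /c; split; [case: asboolP|move=> /asboolP ->].
have cbin x : binary (c x) by move=> n; rewrite /c; case: asbool.
have ci : injective c.
  move=> x y e; apply: mdist_positivity; apply/eqP; rewrite eq_le mdist_ge0 andbT.
  rewrite leNgt; apply/negP => xy; have [n [nx hn]] := hO x _ xy.
  have /hn : Ob n y by apply/cE; rewrite -e; apply/cE.
  by rewrite ltxx.
exists c; split => //.
- pose cl n x := forall e, 0 < e -> exists y, Ob n y /\ d x y < e.
  have -> : range c = [set b | binary b /\
    ((forall k, exists n, b n = 1%N /\ (forall x y, Ob n x -> Ob n y -> d x y < rad k)) /\
    ((forall n, b n = 1%N -> exists n', b n' = 1%N /\ (forall x, cl n' x -> Ob n x)) /\
    ((forall n n', b n = 1%N -> b n' = 1%N -> exists x, Ob n x /\ Ob n' x) /\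
     (forall n n', b n' = 1%N -> (forall x, Ob n' x -> Ob n x) -> b n = 1%N))))].
    apply/seteqP; split => b /=.
    + case=> x _ <-; split => //; split.
        move=> k; have [n [nx hn]] := hO x (rad k / 2) (divr_gt0 (rad_gt0 k) (ltr0Sn _ _)).
        exists n; split; first exact/cE.
        move=> y z ny nz; apply: le_lt_trans (metric_triangle y x z) _.
        by rewrite (splitr (rad k)) metric_sym; apply: ltrD; apply: hn.
      split.
        move=> n /cE nx; have [e [e0 he]] := (open_mdist _).1 (oO n) x nx.
        have e2 : 0 < e / 2 by rewrite divr_gt0.
        have [n' [nx' hn']] := hO x _ e2; exists n'; split; first exact/cE.
        move=> y /(_ _ e2)[z [nz yz]]; apply: he.
        apply: le_lt_trans (metric_triangle x z y) _.
        rewrite (splitr e); apply: ltrD; first exact: hn'.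
        by rewrite /d metric_sym in yz.
      split; first by move=> n n' /cE nx /cE nx'; exists x.
      by move=> n n' /cE nx' h; apply/cE/h.
    + case=> bb [b1 [b2 [b3 b4]]].
      have [nk hnk] := ex_choice b1.
      have /ex_choice[u hu] : forall k, exists x, Ob (nk k) x.
        by move=> k; have [h _] := hnk k; have [x []] := b3 _ _ h h; exists x.
      have dk n x k : b n = 1%N -> Ob n x -> Ob (nk k) x -> d (u k) x < rad k.
        by move=> bn nx kx; have [_] := hnk k; apply.
      have rad_mono m n : (m <= n)%N -> rad n <= rad m.
        by move=> mn; rewrite /rad lef_pV2 ?posrE ?ltr0n // ler_nat.
      have [|l hl] := @mdist_complete u.
        move=> e e0; have [k hk] : exists k, rad k < e / 2 by apply: rad_lt; rewrite divr_gt0.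
        exists k => m n km kn; have [hm hm'] := hnk m; have [hn hn'] := hnk n.
        have [x [mx nx]] := b3 _ _ hm hn.
        apply: le_lt_trans (metric_triangle (u m) x (u n)) _.
        rewrite (splitr e); apply: ltrD.
          by apply: lt_trans (le_lt_trans (rad_mono _ _ km) hk); apply: hm'.
        by apply: lt_trans (le_lt_trans (rad_mono _ _ kn) hk); apply: hn'.
      have near k : forall e, 0 < e -> exists j, (k <= j)%N /\ forall x, Ob (nk j) x -> d l x < e.
        move=> e e0; have e2 : 0 < e / 2 by rewrite divr_gt0.
        have [N hN] := hl _ e2; have [r hr] := rad_lt e2.
        exists (maxn k (maxn N r)); split; first exact: leq_maxl.
        move=> x jx; set j := maxn _ _ in jx *.
        have [jN jr] : (N <= j)%N /\ (r <= j)%N by rewrite /j; split; lia.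
        apply: le_lt_trans (metric_triangle l (u j) x) _.
        rewrite (splitr e); apply: ltrD; first exact: hN.
        apply: lt_trans (le_lt_trans (rad_mono _ _ jr) hr).
        by have [_] := hnk j; apply.
      have bcl n : b n = 1%N -> cl n l.
        move=> bn e e0; have [j [_ hj]] := near 0%N e e0.
        have [hj' _] := hnk j; have [x [nx jx]] := b3 _ _ bn hj'.
        by exists x; split => //; exact: hj.
      exists l => //; apply: funext => n.
      (* The point [l] is in the closure of every coded set, and [b2] finds such a closure inside
         [Ob n]. Conversely a small coded set near [l] lies in [Ob n], and [b4] concludes. *)
      have h : b n = 1%N <-> Ob n l.
        split; first by move=> /b2[n' [/bcl bn' h]]; apply: h.
        move=> nl; have [e [e0 he]] := (open_mdist _).1 (oO n) l nl.
        have [j [_ hj]] := near 0%N e e0; have [hj' _] := hnk j.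
        by apply: b4 hj' _ => x /hj /he.
      have := cE l n; have := bb n; have := cbin l n.
      case: (b n) h => [|[|//]] h; case: (c l n) => [|[|//]] _ _ [h1 h2] //.
        by have /h := h1 erefl.
      by apply: h2; apply/h.
  apply: (sigma_and bS).
    by apply: (sigma_all bS) => n; exact: (borelN_coord n (fun v => v <= 1)%N).
  apply: (sigma_and bS).
    apply: (sigma_all bS) => k; apply: (sigma_ex bS) => n; apply: (sigma_and bS).
      exact: borelN_eq.
    exact: sigma_cst.
  apply: (sigma_and bS).
    apply: (sigma_all bS) => n; apply: (sigma_imp bS); first exact: borelN_eq.
    apply: (sigma_ex bS) => k; apply: (sigma_and bS); first exact: borelN_eq.
    exact: sigma_cst.
  apply: (sigma_and bS).
    apply: (sigma_all bS) => n; apply: (sigma_all bS) => k.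
    apply: (sigma_imp bS); first exact: borelN_eq.
    apply: (sigma_imp bS); first exact: borelN_eq.
    exact: sigma_cst.
  apply: (sigma_all bS) => n; apply: (sigma_all bS) => k.
  apply: (sigma_imp bS); first exact: borelN_eq.
  apply: (sigma_imp bS); first exact: sigma_cst.
  exact: borelN_eq.
- have oS : sigma_algebra setT <<s @open M >> by exact: smallest_sigma_algebra.
  apply/seteqP; split.
    apply: smallest_sub.
      have := sigma_algebra_preimage setT c bS.
      rewrite /preimage_set_system; congr (sigma_algebra _ _).
      by apply: eq_imagel => B _; rewrite setTI.
    move=> U oU; exists [set b | exists n, (forall x, Ob n x -> U x) /\ b n = 1%N].
      apply: (sigma_ex bS) => n; apply: (sigma_and bS); first exact: sigma_cst.
      exact: borelN_eq.
    apply/seteqP; split => x /=; first by case=> n [h /cE nx]; apply: h.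
    move=> Ux; have [e [e0 he]] := (open_mdist U).1 oU x Ux.
    have [n [nx hn]] := hO x e e0; exists n; split; last exact/cE.
    by move=> z /hn /he.
  move=> _ [B bB <-]; apply: (borelN_preimage oS) bB => i j.
  have oi : <<s @open M >> [set x | Ob i x] by apply: sub_sigma_algebra; exact: oO.
  case: j => [|[|j]].
  - rewrite (_ : [set x | _] = [set x | ~ Ob i x]); first exact: (sigma_not oS).
    by apply/seteqP; split => x /=; rewrite /c; case: asboolP.
  - rewrite (_ : [set x | _] = [set x | Ob i x]) //.
    by apply/seteqP; split => x /= /cE.
  - rewrite (_ : [set x | _] = [set x | False]); first exact: (sigma_cst oS).
    by apply/seteqP; split => x //=; rewrite /c; case: asboolP.
Qed.

End PolishCode.

Lemma standard_borel_code (R : realType) (X : standardBorelType R) :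
  exists c : X -> baire, [/\ forall x, binary (c x), injective c, borelN (range c) &
      borel X = [set c @^-1` B | B in borelN]].
Proof.
have [M [hM [f [[g fK gK] ->]]]] := borelP X.
have [c [cb ci cr ->]] := polish_code hM.
exists (c \o f); split => //.
- by move=> x; exact: cb.
- exact: inj_comp ci (can_inj fK).
- rewrite (_ : range _ = range c) //; apply/seteqP; split => a /= [x _ <-].
    by exists (f x).
  by exists (g x) => //=; rewrite gK.
- apply/seteqP; split => A /=; first by case=> _ [B bB <-] <-; exists B.
  by case=> B bB <-; exists (c @^-1` B) => //; exists B.
Qed.

Lemma borel_sigma (R : realType) (X : standardBorelType R) :
  sigma_algebra setT (borel X).
Proof.
have [c [_ _ _ ->]] := standard_borel_code X.
have := sigma_algebra_preimage setT c borelN_sigma.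
rewrite /preimage_set_system; congr (sigma_algebra _ _).
by apply: eq_imagel => B _; rewrite setTI.
Qed.

(** * Normal form of a smooth pair *)

Definition borel_map (R : realType) (X : standardBorelType R) (e : X -> baire) :=
  forall i j, borel X [set x | e x i = j].

Definition join2 (a b : baire) : baire := join (fun i => if i is 0%N then a else b).

Lemma borelN_sec_coord k i j : borelN [set z | sec k z i = j].
Proof. exact: (borelN_coord (pickle (k, i)) (fun v => v = j)). Qed.

Lemma borel_map_join2 (R : realType) (X : standardBorelType R) (e f : X -> baire) :
  borel_map e -> borel_map f -> borel_map (fun x => join2 (e x) (f x)).
Proof.
move=> he hf n v; rewrite /join2 /join.
case: pickle_inv => [[[|i] j]|] /=; [exact: he|exact: hf|].
exact: (sigma_cst (borel_sigma X)).
Qed.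

Section StandardBorelMaps.
Variables (R : realType) (X : standardBorelType R).

Let bS := borelN_sigma.
Let bX := borel_sigma X.

Section Code.
Variables (c : X -> baire) (cr : borelN (range c))
  (cX : borel X = [set c @^-1` B | B in borelN]).

(** Each condition [e x i = j] is a Borel condition on the code of [x], so countably many of them
    cut out the graph. In [join2] all rows from 1 on repeat the second point, hence the quantifier
    over [k]. *)
Lemma borelN_graph (A : set X) (e : X -> baire) : borel X A -> borel_map e ->
  borelN [set join2 (c x) (e x) | x in A].
Proof.
move=> bA be.
have /ex_choice[B hB] : forall ij : nat * nat, exists B, borelN B /\
    forall x, B (c x) <-> e x ij.1 = ij.2.
  move=> [i j]; have := be i j; rewrite cX => -[B bB e1]; exists B; split => // x /=.
  by rewrite -[e x i = j]/([set x | e x i = j] x) -e1.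
have [A' [bA' hA']] : exists A', borelN A' /\ forall x, A' (c x) <-> A x.
  by move: bA; rewrite cX => -[A' bA' <-]; exists A'.
have -> : [set join2 (c x) (e x) | x in A] = [set z |
    (forall n, (pickle_inv n : option (nat * nat)) = None -> z n = 0%N) /\
    (range c (sec 0%N z) /\ (A' (sec 0%N z) /\
     (forall k i j, B (i, j) (sec 0%N z) -> sec k.+1 z i = j)))].
  apply/seteqP; split => z /=.
  - case=> x Ax <-; split; first exact: joined_join.
    rewrite !sec_join; split; first by exists x.
    split; first exact/hA'.
    by move=> k i j /=; have [_ hx] := hB (i, j); rewrite /join2 !sec_join => /hx.
  - case=> jz [[x _ xz] [Az Bz]]; exists x; first by apply/hA'; rewrite xz.
    apply: joined_inj => // [|[|k]]; first exact: joined_join.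
      by rewrite sec_join.
    rewrite sec_join; apply: funext => i; apply/esym/Bz; rewrite -xz.
    by have [_ h] := hB (i, e x i); apply/h.
have hs k : forall i j, borelN [set z | sec k z i = j] by exact: borelN_sec_coord.
apply: (sigma_and bS).
  apply: (sigma_all bS) => n; apply: (sigma_imp bS); first exact: (sigma_cst bS).
  exact: borelN_eq.
apply: (sigma_and bS); first exact: (borelN_preimage bS (hs 0%N) cr).
apply: (sigma_and bS); first exact: (borelN_preimage bS (hs 0%N) bA').
apply: (sigma_all bS) => k; apply: (sigma_all bS) => i; apply: (sigma_all bS) => j.
apply: (sigma_imp bS); last exact: hs.
by apply: (borelN_preimage bS (hs 0%N)); have [] := hB (i, j).
Qed.

End Code.

(** The graph of [f] over [A] is Borel, hence an injective image of a closed set; its projection to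
    the second coordinate stays injective because [f] is. *)
Lemma lusin_souslin_borel (A : set X) (f : X -> baire) : borel X A -> borel_map f ->
  (forall x y, A x -> A y -> f x = f y -> x = y) -> borelN (f @` A).
Proof.
move=> bA bf fi; have [c [_ _ cr cX]] := standard_borel_code X.
have [K [h [hK hh hi hA]]] := borelN_inj_ana (borelN_graph cr cX bA bf).
have hx a : K a -> exists x, A x /\ h a = join2 (c x) (f x).
  move=> Ka; have : (h @` K) (h a) by exists a.
  by rewrite -hA => -[x Ax e]; exists x.
have -> : f @` A = (sec 1 \o h) @` K.
  apply/seteqP; split => y /=.
    case=> x Ax <-; have : (h @` K) (join2 (c x) (f x)) by rewrite -hA; exists x.
    by case=> a Ka e; exists a => //; rewrite e sec_join.
  by case=> a Ka <-; have [x [Ax ->]] := hx a Ka; rewrite sec_join; exists x.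
apply: lusin_souslin => //; first exact: contN_comp (contN_sec 1) hh.
move=> a b Ka Kb /=.
have [x [Ax ha]] := hx a Ka; have [y [Ay hb]] := hx b Kb.
rewrite ha hb !sec_join => /(fi _ _ Ax Ay) exy; apply: hi => //.
by rewrite ha hb exy.
Qed.

(** A closed set of parameters for the graph of [(e, f)] brings in Lusin-Novikov; [j x] is the least
    index of a partial section containing [e x]. *)
Lemma lusin_novikov_borel (e f : X -> baire) : borel_map e -> borel_map f ->
  (forall x y, e x = e y -> f x = f y) -> (forall x, countable [set y | f x = f y]) ->
  exists j : X -> nat, [/\ forall n, borel X [set x | j x = n],
    forall x y, e x = e y -> j x = j y & forall x y, f x = f y -> j x = j y -> e x = e y].
Proof.
move=> be bf ef fc; have [c [_ _ cr cX]] := standard_borel_code X.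
have bT : borel X setT by exact: (sigma_cst bX True).
have [K [h [hK hh _ hA]]] := borelN_inj_ana (borelN_graph cr cX bT (borel_map_join2 be bf)).
pose p := sec 0%N \o (sec 1 \o h); pose q := sec 1%N \o (sec 1 \o h).
have hp : contN p by do 2!(apply: contN_comp; first exact: contN_sec).
have hq : contN q by do 2!(apply: contN_comp; first exact: contN_sec).
have Kx a : K a -> exists x, p a = e x /\ q a = f x.
  move=> Ka; have : (h @` K) (h a) by exists a.
  by rewrite -hA => -[x _ e1]; exists x; rewrite /p /q /= -e1 !sec_join.
have xK x : exists a, [/\ K a, p a = e x & q a = f x].
  have : (h @` K) (join2 (c x) (join2 (e x) (f x))) by rewrite -hA; exists x.
  by case=> a Ka e1; exists a; rewrite /p /q /= e1 !sec_join.
have [W [bW cW iW]] : exists W : nat -> set baire,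
    [/\ forall i, borelN (W i), forall a, K a -> exists i, W i (p a) &
        forall i, fiber_inj K p q (W i)].
  apply: lusin_novikov => //.
    move=> a b Ka Kb; have [x [-> ->]] := Kx a Ka; have [y [-> ->]] := Kx b Kb.
    exact: ef.
  move=> a Ka; have [x [_ qx]] := Kx a Ka.
  apply: (@sub_countable _ _ _ (e @` [set y | f x = f y])); last first.
    by apply: sub_countable (fc x); exact: card_image_le.
  apply: subset_card_le => _ [b [Kb qb] <-]; have [y [py qy]] := Kx b Kb.
  by exists y; rewrite ?py //= -qx -qb.
(* The index is chosen on [baire] and not on [X], so that [j x] depends only on [e x]. *)
have /ex_choice[J hJ] : forall y, exists n, (exists i, W i y) ->
    W n y /\ forall i, (i < n)%N -> ~ W i y.
  move=> y; case: (pselect (exists i, W i y)) => [[i Wi]|hn]; last by exists 0%N.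
  have ex : exists i, `[< W i y >] by exists i; apply/asboolP.
  have [n /asboolP Wn hn] := ex_minnP ex; exists n => _; split => // k kn Wk.
  by have := hn k (asboolT Wk); rewrite leqNgt kn.
have hJe x : W (J (e x)) (e x) /\ forall i, (i < J (e x))%N -> ~ W i (e x).
  by apply: hJ; have [a [Ka <- _]] := xK x; exact: cW.
exists (J \o e); split => [n|x y /= -> //|x y fxy /= jxy].
- rewrite (_ : [set x | _] = [set x | W n (e x) /\ forall i, (i < n)%N -> ~ W i (e x)]).
    apply: (sigma_and bX); first exact: (borelN_preimage bX be (bW n)).
    apply: (sigma_all bX) => i; apply: (sigma_imp bX); first exact: (sigma_cst bX).
    by apply: (sigma_not bX); exact: (borelN_preimage bX be (bW i)).
  apply/seteqP; split => x /=; first by move=> <-; exact: hJe.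
  case=> Wn hn; have [WJ hJ'] := hJe x; case: (ltngtP (J (e x)) n) => // h'.
    by have := hn _ h'.
  by have := hJ' _ h'.
- have [a [Ka pa qa]] := xK x; have [b [Kb pb qb]] := xK y.
  rewrite -pa -pb in jxy *.
  apply: (iW (J (p a))) => //; last by rewrite qa qb.
  + by apply: (proj1 (hJ (p a) _)); exact: cW.
  + by rewrite jxy; apply: (proj1 (hJ (p b) _)); exact: cW.
Qed.

End StandardBorelMaps.

(* A class of [F] is a point [w] in the image of [f], and its classes of [E] are
   numbered by an initial segment of the natural numbers; [T] is a Borel
   transversal of [E]. *)
Record normal_form (R : realType) (X : standardBorelType R) (E F : X -> X -> Prop)
    (f : X -> baire) (i : X -> nat) (T : set X) : Prop := {
  nf_binary : forall x, binary (f x);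
  nf_map : borel_map f;
  nf_index : forall n, borel X [set x | i x = n];
  nf_F : forall x y, F x y <-> f x = f y;
  nf_E : forall x y, E x y <-> f x = f y /\ i x = i y;
  nf_initial : forall x m, (m < i x)%N -> exists y, f y = f x /\ i y = m;
  nf_transversal : borel X T;
  nf_meets : forall x, exists y, [/\ T y, f y = f x & i y = i x];
  nf_unique : forall x y, T x -> T y -> f x = f y -> i x = i y -> x = y;
  nf_image : forall A, borel X A -> borelN (f @` A)
}.

Section BorelCount.
Variables (T : Type) (S : set (set T)) (A : nat -> T -> Prop).
Hypotheses (hS : sigma_algebra setT S) (hA : forall b, S [set x | A b x]).

(** Counting the indices in use below [m] turns a numbering with gaps into one by an initial
    segment. *)
Definition count_below (x : T) m := count (fun b => `[< A b x >]) (iota 0 m).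

Lemma count_belowS x m : count_below x m.+1 = (count_below x m + `[< A m x >])%N.
Proof. by rewrite /count_below -addn1 iotaD count_cat /= addn0. Qed.

Lemma count_below_le x m n : (m <= n)%N -> (count_below x m <= count_below x n)%N.
Proof.
move=> /subnK <-; elim: (n - m)%N => // k ih.
by rewrite addSn count_belowS; apply: leq_trans ih (leq_addr _ _).
Qed.

Lemma count_below_witness x M m : (m < count_below x M)%N ->
  exists b, [/\ (b < M)%N, A b x & count_below x b = m].
Proof.
elim: M => // M ih; rewrite count_belowS => hm.
case: (ltnP m (count_below x M)) => h.
  by have [b [bM ? ?]] := ih h; exists b; split => //; exact: ltnW.
by exists M; split => //; move: hm; case: asboolP => //; lia.
Qed.

Lemma sigma_count_below m n : S [set x | count_below x m = n].
Proof.
elim: m n => [|m ih] n.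
  rewrite (_ : [set x | _] = [set x | 0%N = n]) //; exact: (sigma_cst hS).
rewrite (_ : [set x | _] = [set x |
    (A m x /\ exists k, n = k.+1 /\ count_below x m = k) \/ (~ A m x /\ count_below x m = n)]).
  apply: (sigma_or hS); apply: (sigma_and hS) => //; last exact: (sigma_not hS).
  apply: (sigma_ex hS) => k; apply: (sigma_and hS); first exact: (sigma_cst hS).
  exact: ih.
apply/seteqP; split => x /=; rewrite count_belowS; case: asboolP => Ax.
- by rewrite addn1 => <-; left; split => //; exists (count_below x m).
- by rewrite addn0 => <-; right.
- by case=> [[_ [k [-> ->]]]|[]//]; rewrite addn1.
- by case=> [[]//|[_ <-]]; rewrite addn0.
Qed.

End BorelCount.

Lemma smooth_code (R : realType) (X : standardBorelType R) (E : X -> X -> Prop) :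
  smooth E -> exists e : X -> baire, [/\ forall x, binary (e x), borel_map e &
    forall x y, E x y <-> e x = e y].
Proof.
case=> Z [f [bf Ef]]; have [c [cb ci _ cZ]] := standard_borel_code Z.
exists (c \o f); split => [x|i j|x y]; first exact: cb.
  apply: (bf [set z | c z i = j]); rewrite cZ; exists [set a | a i = j] => //.
  exact: borelN_eq.
by rewrite Ef /=; split => [->|/ci].
Qed.

(** Lusin-Novikov numbers the points of each [E]-class by [k] and the [E]-classes of each [F]-class
    by [j]. Where [k] is fixed [e] is injective, and where [j] is fixed too so is [f]; hence Borel
    images. Then [i] removes the gaps of [j], and [T] takes the point of least [k] in each
    [E]-class. *)
Theorem smooth_normal_form (R : realType) (X : standardBorelType R) (E F : X -> X -> Prop) :
  smooth E -> smooth F -> (forall x, countable [set y | F x y]) ->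
  (forall x y, E x y -> F x y) -> exists f i T, normal_form E F f i T.
Proof.
move=> /smooth_code[e [_ be Ee]] /smooth_code[f [fb bf Ff]] cF EF.
have bX := borel_sigma X; have bS := borelN_sigma.
have ef x y : e x = e y -> f x = f y by move=> /Ee/EF/Ff.
have cf x : countable [set y | f x = f y].
  by apply: sub_countable (cF x); apply: subset_card_le => y /Ff.
have [c [_ ci _ cX]] := standard_borel_code X.
have bc : borel_map c.
  by move=> i j; rewrite cX; exists [set a | a i = j] => //; exact: borelN_eq.
have [k [bk _ ki]] : exists k : X -> nat, [/\ forall n, borel X [set x | k x = n],
    forall x y, c x = c y -> k x = k y & forall x y, e x = e y -> k x = k y -> c x = c y].
  apply: lusin_novikov_borel => // [x y /ci -> //|x].
  by apply: sub_countable (cf x); apply: subset_card_le => y /ef.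
have {}ki x y : e x = e y -> k x = k y -> x = y by move=> h1 h2; apply: ci; apply: ki.
have [j [bj je ji]] := lusin_novikov_borel be bf ef cf.
have ime A : borel X A -> borelN (e @` A).
  move=> bA; rewrite (_ : e @` A = [set w | exists a, (e @` [set x | A x /\ k x = a]) w]).
    apply: (sigma_ex bS) => a; apply: lusin_souslin_borel => //.
      exact: (sigma_and bX).
    by move=> x y [_ <-] [_ kk] exy; apply: ki.
  apply/seteqP; split => w /=; first by case=> x Ax <-; exists (k x), x.
  by case=> a [x [Ax _] <-]; exists x.
have imf A : borel X A -> borelN (f @` A).
  move=> bA; rewrite (_ : f @` A = [set w | exists a b,
      (f @` [set x | A x /\ (k x = a /\ j x = b)]) w]).
    apply: (sigma_ex bS) => a; apply: (sigma_ex bS) => b.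
    apply: lusin_souslin_borel => //.
      by apply: (sigma_and bX) => //; apply: (sigma_and bX).
    move=> x y [_ [<- <-]] [_ [kk jj]] fxy; apply: ki => //.
    exact: ji.
  apply/seteqP; split => w /=; first by case=> x Ax <-; exists (k x), (j x), x.
  by case=> a [b [x [Ax _] <-]]; exists x.
pose V b : set baire := f @` [set x | j x = b].
have bV b : borelN (V b) by exact: imf.
have bVf b : borel X [set x | V b (f x)] by exact: (borelN_preimage bX bf (bV b)).
pose N w m := count_below V w m.
pose i x := N (f x) (j x).
pose T : set X := [set x | exists n, k x = n /\
  forall a, (a < n)%N -> ~ (e @` [set y | k y = a]) (e x)].
have eE x y : f x = f y -> i x = i y -> e x = e y.
  (* Within an [F]-class [i] is strictly increasing in [j], because [j x'] is itself one of the
     numbers counted. *)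
  move=> fxy; have lt x' y' : f x' = f y' -> (j x' < j y')%N -> (i x' < i y')%N.
    move=> fe jlt; have := count_below_le V (f y') jlt.
    rewrite count_belowS -[count_below V _ (j y')]/(i y').
    rewrite (_ : `[< _ >] = true); first by rewrite -fe addn1.
    by apply/asboolP; exists x'.
  move=> ixy; apply: ji => //; case: (ltngtP (j x) (j y)) => // h.
    by have := lt _ _ fxy h; rewrite ixy ltnn.
  by have := lt _ _ (esym fxy) h; rewrite ixy ltnn.
have Ei x y : e x = e y -> f x = f y /\ i x = i y.
  by move=> h; rewrite /i (ef _ _ h) (je _ _ h).
exists f, i, T; split => //.
- move=> n; rewrite (_ : [set x | _] = [set x | exists m, j x = m /\ N (f x) m = n]).
    apply: (sigma_ex bX) => m; apply: (sigma_and bX) => //.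
    exact: (sigma_count_below (A := fun b x => V b (f x)) bX bVf).
  by apply/seteqP; split => x /= => [?|[m [<-]]] //; exists (j x).
- by move=> x y; rewrite Ee; split => [/Ei|[/eE]].
- move=> x m mi; have [b [_ [y jy fy] Nb]] := count_below_witness (mi : m < N _ _)%N.
  exists y; split => //.
  by rewrite /i fy jy.
- apply: (sigma_ex bX) => n; apply: (sigma_and bX) => //.
  apply: (sigma_all bX) => a; apply: (sigma_imp bX); first exact: (sigma_cst bX).
  apply: (sigma_not bX).
  exact: (borelN_preimage bX be (ime _ (bk a))).
- move=> x.
  have ex : exists a, `[< exists y, k y = a /\ e y = e x >].
    by exists (k x); apply/asboolP; exists x.
  have [a /asboolP[y [ky ey]] ha] := ex_minnP ex; exists y.
  have [fy iy] := Ei _ _ ey; split => //; exists a; split => // a' aa [z kz ez].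
  have : (a <= a')%N by apply: ha; apply/asboolP; exists z; rewrite ez.
  by rewrite leqNgt aa.
- move=> x y [n [kx hx]] [m [ky hy]] fxy ixy; have exy := eE _ _ fxy ixy.
  apply: ki => //; rewrite kx ky; case: (ltngtP n m) => // h.
    by case: (hy _ h); exists x.
  by case: (hx _ h); exists y.
Qed.

(** * Graded injections *)

Definition graded_inj (D D' : nat -> set baire) (R R' : set baire) (g : baire -> baire) :=
  [/\ forall x, R x -> R' (g x), forall x y, R x -> R y -> g x = g y -> x = y &
      forall n x, R x -> D n x -> D' n (g x)].

Lemma card_le_baireP (T : Type) (A : set T) (B : set baire) : A #<= B ->
  exists g : T -> baire, (forall x, A x -> B (g x)) /\
    (forall x y, A x -> A y -> g x = g y -> x = y).
Proof.
move=> /pcard_leP/injfunPex[g gf gi]; exists g; split => [x Ax|x y Ax Ay e].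
  exact: gf.
by apply: gi => //; rewrite inE.
Qed.

Lemma decreasing_le (D : nat -> set baire) : (forall n, D n.+1 `<=` D n) ->
  forall m n, (m <= n)%N -> D n `<=` D m.
Proof.
move=> dD m n /subnK <-; elim: (n - m)%N => // k ih.
by apply: subset_trans ih; exact: dD.
Qed.

Lemma grade_exists (D : nat -> set baire) x : D 0%N x -> ~ (forall n, D n x) ->
  exists n, D n x /\ ~ D n.+1 x.
Proof.
move=> D0 nD; apply: contrapT => hn; apply: nD; elim => // n Dn.
by apply: contrapT => h; apply: hn; exists n.
Qed.

(** Greedy choice: an infinite set has a point outside the finite list chosen so far. *)
Lemma distinct_representatives (T : choiceType) (W : nat -> set T) :
  (forall n, infinite_set (W n)) -> exists u, injective u /\ forall n, W n (u n).
Proof.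
move=> hW.
have /ex_choice[nx hnx] : forall l : seq T, exists x, W (size l) x /\ x \notin l.
  move=> l; have [x [Wx xl]] := infinite_setN0 (infinite_setD (hW (size l)) (finite_seq l)).
  by exists x; split => //; exact/negP.
pose L := fix L n := if n is m.+1 then rcons (L m) (nx (L m)) else [::].
have szL n : size (L n) = n by elim: n => //= n ih; rewrite size_rcons ih.
exists (nx \o L); split => [|n /=]; last by have [] := hnx (L n); rewrite szL.
have mem m n : (m < n)%N -> nx (L m) \in L n.
  move=> /subnK <-; elim: (n - m.+1)%N => [|k ih] /=; first by rewrite mem_rcons mem_head.
  by rewrite mem_rcons inE ih orbT.
move=> m n /= e; case: (ltngtP m n) => // h.
  by have [_ /negP[]] := hnx (L n); rewrite -e; exact: mem.
by have [_ /negP[]] := hnx (L m); rewrite e; exact: mem.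
Qed.

(** Finite counting: [g] uses as many points of [B'] as [A] has, so the rest of [A'] fits into what
    remains. *)
Lemma extend_injection (A A' B B' : set baire) g : A `<=` A' -> B `<=` B' ->
  finite_set B' -> A' #<= B' -> (forall x, A x -> B (g x)) ->
  (forall x y, A x -> A y -> g x = g y -> x = y) ->
  exists g', [/\ forall x, A x -> g' x = g x, forall x, A' x -> B' (g' x) &
     forall x y, A' x -> A' y -> g' x = g' y -> x = y].
Proof.
move=> AA BB fB' cAB gB gi.
have fA' : finite_set A' := card_le_finite cAB fB'.
have fA : finite_set A := sub_finite_set AA fA'.
have gAB : g @` A `<=` B' by move=> _ [x Ax <-]; exact/BB/gB.
have fgA : finite_set (g @` A) := sub_finite_set gAB fB'.
have cardE (S : set baire) : finite_set S -> S #= `I_(#|` fset_set S|).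
  by move=> fS; rewrite -{1}(fset_setK fS); exact/card_eq_fsetP.
have cardD (S S' : set baire) : S `<=` S' -> finite_set S' ->
    #|` fset_set (S' `\` S)| = (#|` fset_set S'| - #|` fset_set S|)%N.
  move=> SS fS'; have fS := sub_finite_set SS fS'.
  rewrite fset_setD // cardfsD (_ : (_ `&` _)%fset = fset_set S) //.
  by rewrite -fset_setI // setIidr.
have le1 : (#|` fset_set A'| <= #|` fset_set B'|)%N.
  rewrite -card_le_II -(card_le_eql (cardE _ fA')) -(card_le_eqr (cardE _ fB')) //.
have e1 : #|` fset_set (g @` A)| = #|` fset_set A|.
  apply/card_fset_set; apply: card_eq_trans (cardE _ fA).
  by apply: inj_card_eq => x y; rewrite !inE; exact: gi.
have : A' `\` A #<= B' `\` g @` A.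
  rewrite (card_le_eql (cardE _ (finite_setD _ fA'))).
  rewrite (card_le_eqr (cardE _ (finite_setD _ fB'))) card_le_II !cardD // e1.
  exact: leq_sub2r.
move=> /card_le_baireP[h [hB hi]].
exists (fun x => if pselect (A x) then g x else h x); split => [x|x|x y].
- by case: pselect.
- case: pselect => Ax A'x; first exact/BB/gB.
  by have [] := hB x (conj A'x Ax).
- case: pselect => Ax; case: pselect => Ay A'x A'y e.
  + exact: gi.
  + by have [_ []] := hB y (conj A'y Ay); exists x.
  + by have [_ []] := hB x (conj A'x Ax); exists y.
  + exact: hi.
Qed.

Lemma finite_decreasing_stable (D : nat -> set baire) : (forall n, D n.+1 `<=` D n) ->
  finite_set (D 0%N) -> exists M, forall n, (M <= n)%N -> D n = D M.
Proof.
move=> dD f0; have le := decreasing_le dD.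
have fD n : finite_set (D n) := sub_finite_set (le _ _ (leq0n n)) f0.
have ex : exists k, `[< exists n, #|` fset_set (D n)| = k >].
  by exists #|` fset_set (D 0%N)|; apply/asboolP; exists 0%N.
have [k /asboolP[M hM] hk] := ex_minnP ex; exists M => n Mn.
have sub : (fset_set (D n) `<=` fset_set (D M))%fset by rewrite -fset_set_sub //; exact: le.
have : fset_set (D n) = fset_set (D M).
  apply/eqP; rewrite eqEfcard sub /= hM; apply: hk; apply/asboolP; by exists n.
by move=> /fset_set_inj; apply.
Qed.

Section GradedInjections.
Variables D D' : nat -> set baire.
Hypotheses (dD : forall n, D n.+1 `<=` D n) (dD' : forall n, D' n.+1 `<=` D' n)
  (cD : forall n, D n #<= D' n)
  (cinf : [set w | forall n, D n w] #<= [set w | forall n, D' n w]).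

Let leD := decreasing_le dD.
Let leD' := decreasing_le dD'.

(* Beyond a stage [M] where [D'] is constant any injection is graded; it is then
   extended downwards one layer at a time. *)
Lemma graded_inj_finite N : finite_set (D' N) -> exists g, graded_inj D D' (D N) (D' N) g.
Proof.
move=> fN.
have [M hM] : exists M, forall n, (M <= n)%N -> D' (N + n)%N = D' (N + M)%N.
  apply: (@finite_decreasing_stable (fun n => D' (N + n)%N)); last by rewrite addn0.
  by move=> n; rewrite addnS; exact: dD'.
have ext k : (k <= M)%N ->
    exists g, graded_inj D D' (D (N + (M - k))%N) (D' (N + (M - k))%N) g.
  elim: k => [_|k ih kM].
    rewrite subn0; have [g [gD gi]] := card_le_baireP (cD (N + M)%N).
    exists g; split => // n x Dx Dn; case: (leqP n (N + M)) => h.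
      by apply: (leD' h); apply: gD.
    have -> : D' n = D' (N + M)%N by rewrite -(hM (n - N)%N); [congr D'; lia|lia].
    exact: gD.
  have [g [gD gi gn]] := ih (ltnW kM).
  have [||||||g' [gE gD' gi']] := @extend_injection (D (N + (M - k))%N)
    (D (N + (M - k.+1))%N) (D' (N + (M - k))%N) (D' (N + (M - k.+1))%N) g => //.
  - by apply: leD; lia.
  - by apply: leD'; lia.
  - by apply: sub_finite_set fN; apply: leD'; lia.
  exists g'; split => // n x Dx Dn; case: (leqP n (N + (M - k.+1))) => h.
    by apply: (leD' h); exact: gD'.
  have Dx' : D (N + (M - k))%N x by apply: leD Dn; lia.
  by rewrite gE //; exact: gn.
by have := ext M (leqnn M); rewrite subnn addn0.
Qed.

(* Points outside [R] are sent to distinct representatives of infinite sets. *)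
Lemma graded_inj_infinite (R R' : set baire) g : countable (D 0%N) ->
  graded_inj D D' R R' g ->
  (forall x, D 0%N x -> ~ R x -> exists n,
     (forall m, D m x -> (m <= n)%N) /\ infinite_set (D' n `\` R')) ->
  exists g', graded_inj D D' (D 0%N) (D' 0%N) g'.
Proof.
move=> /countable_injP[r ri] [gR gi gn] hR.
have {}ri x y : D 0%N x -> D 0%N y -> r x = r y -> x = y.
  by move=> Dx Dy; apply: ri; rewrite inE.
case: (pselect (exists x, D 0%N x /\ ~ R x)) => [[x0 [Dx0 Rx0]]|hn]; last first.
  have hRx x : D 0%N x -> R x by move=> Dx; apply: contrapT => h; apply: hn; exists x.
  exists g; split => [x /[dup]/hRx Rx Dx|x y /hRx Rx /hRx Ry|n x /hRx Rx Dn].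
  - exact: gn.
  - exact: gi.
  - exact: gn.
have [n0 [_ hn0]] := hR x0 Dx0 Rx0.
(* The target set is indexed by the code [r x]; a code of no point outside [R] gets the default
   [n0], which keeps every set of the family infinite. *)
have /ex_choice[t ht] : forall k, exists n, infinite_set (D' n `\` R') /\
    forall x, D 0%N x -> ~ R x -> r x = k -> forall m, D m x -> (m <= n)%N.
  move=> k; case: (pselect (exists x, [/\ D 0%N x, ~ R x & r x = k])).
    move=> [x [Dx Rx rx]]; have [n [hn inf]] := hR x Dx Rx; exists n; split => // y Dy _ ry.
    by rewrite (ri y x) // ry.
  by move=> hn; exists n0; split => // x Dx Rx rx; case: hn; exists x.
have [u [ui uW]] : exists u, injective u /\ forall k, (D' (t k) `\` R') (u k).
  apply: (@distinct_representatives baire (fun k => D' (t k) `\` R')) => k.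
  by have [] := ht k.
have graded n x : D 0%N x -> D n x -> D' n (if pselect (R x) then g x else u (r x)).
  move=> Dx Dn; case: pselect => Rx; first exact: gn.
  have [_ h] := ht (r x); have [Dt _] := uW (r x).
  by apply: leD' Dt; exact: h Dn.
exists (fun x => if pselect (R x) then g x else u (r x)); split => [x Dx|x y|n x].
- exact: graded.
- case: pselect => Rx; case: pselect => Ry Dx Dy /= e.
  + exact: gi.
  + by have [_ []] := uW (r y); rewrite -e; exact: gR.
  + by have [_ []] := uW (r x); rewrite e; exact: gR.
  + by apply: ri => //; exact: ui.
- exact: graded.
Qed.

(** If the intersection of the [D' n] is infinite it receives everything, its points having every
    grade. If some [D' n] is finite, finite counting handles [D N] for the least such [N], and the
    points outside have grade below [N], where [D'] is infinite. Otherwise the intersection is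
    handled apart, and the points outside it have a finite grade. *)
Lemma graded_inj_countable : countable (D' 0%N) ->
  exists g, graded_inj D D' (D 0%N) (D' 0%N) g.
Proof.
move=> c0'; have c0 : countable (D 0%N) := sub_countable (cD 0%N) c0'.
case: (pselect (finite_set [set w | forall n, D' n w])) => [finf|inf]; last first.
  have [g [gD gi]] := card_le_baireP (card_le_trans c0 ((infiniteP _).1 inf)).
  by exists g; split => // [x /gD|n x /gD].
case: (pselect (exists n, finite_set (D' n))) => [hfin|hinf].
  have ex : exists n, `[< finite_set (D' n) >] by have [n ?] := hfin; exists n; apply/asboolP.
  have [N /asboolP fN hN] := ex_minnP ex; have [g hg] := graded_inj_finite fN.
  apply: (graded_inj_infinite c0 hg) => x Dx Nx.
  case: N => [//|N] in fN hN hg Nx *.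
  exists N; split => [m Dm|].
    by rewrite leqNgt; apply/negP => h; apply: Nx; apply: leD Dm.
  apply: infinite_setD => // fN'; have := hN N (asboolT fN').
  by rewrite ltnn.
have [g [gD gi]] := card_le_baireP cinf.
have hg : graded_inj D D' [set w | forall n, D n w] [set w | forall n, D' n w] g.
  by split => // n x /gD.
apply: (graded_inj_infinite c0 hg) => x Dx nx; have [n [Dn nDn]] := grade_exists Dx nx.
exists n; split.
  move=> m Dm; rewrite leqNgt; apply/negP => h; apply: nDn; exact: leD Dm.
by apply: infinite_setD => // fn; apply: hinf; exists n.
Qed.

End GradedInjections.

(** * Borel graded injections *)

Lemma countable_borelN A : countable A -> borelN A.
Proof.
move=> /countable_injP[r ri]; have bS := borelN_sigma.
rewrite (_ : A = [set w | exists n, A w /\ r w = n]); last first.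
  by apply/seteqP; split => w /=; [exists (r w)|case=> n []].
apply: (sigma_ex bS) => n; case: (pselect (exists w, A w /\ r w = n)) => [[w [Aw rw]]|hn].
  rewrite (_ : [set _ | _] = [set a | forall k, a k = w k]).
    by apply: (sigma_all bS) => k; exact: borelN_eq.
  apply/seteqP; split => a /=.
    by case=> Aa ra; rewrite (ri a w) ?inE // ra.
  by move=> /funext ->.
rewrite (_ : [set _ | _] = [set a | False]); first exact: (sigma_cst bS).
by apply/seteqP; split => a //= h; apply: hn; exists a.
Qed.

Lemma countableU (T : Type) (A B : set T) : countable A -> countable B -> countable (A `|` B).
Proof.
move=> cA cB; apply: contrapT => h.
exact: (uncountable_remainder cA (fun x Ax => Ax) h cB).
Qed.

(** [D n] is covered by the intersection and by the exact layers of index at least [n], countably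
    many sets. *)
Lemma uncountable_layer (D : nat -> set baire) n : (forall n, D n.+1 `<=` D n) ->
  countable [set w | forall n, D n w] -> ~ countable (D n) ->
  exists k, (n <= k)%N /\ ~ countable (D k `\` D k.+1).
Proof.
move=> dD cinf nD; apply: contrapT => hn; apply: nD.
apply: sub_countable (countableU cinf (_ : countable
  (\bigcup_(k in [set k | (n <= k)%N]) (D k `\` D k.+1)))); last first.
  apply: bigcup_countable; first exact: countableP.
  by move=> k nk; apply: contrapT => h; apply: hn; exists k.
apply: subset_card_le => w Dw; case: (pselect (forall n, D n w)) => h; [by left|right].
have D0 : D 0%N w by apply: decreasing_le Dw.
have [k [Dk nDk]] := grade_exists D0 h; exists k => //=.
rewrite leqNgt; apply/negP => kn; apply: nDk; exact: decreasing_le Dw.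
Qed.

Section BorelGradedInjection.
Variables D D' : nat -> set baire.
Hypotheses (dD : forall n, D n.+1 `<=` D n) (dD' : forall n, D' n.+1 `<=` D' n)
  (bD : forall n, borelN (D n)) (bD' : forall n, borelN (D' n))
  (binD : forall w, D 0%N w -> binary w)
  (cD : forall n, D n #<= D' n)
  (cinf : [set w | forall n, D n w] #<= [set w | forall n, D' n w]).

Let leD := decreasing_le dD.
Let leD' := decreasing_le dD'.
Let bS := borelN_sigma.

Let borel_graded g := graded_inj D D' (D 0%N) (D' 0%N) g /\
  forall B, borelN B -> borelN [set w | D 0%N w /\ B (g w)].

(* Countable sets are Borel, so on [R] measurability is free; elsewhere a perfect
   subset of an exact layer of [D'] receives everything of lower grade. *)
Let borel_graded_glue (R R' : set baire) g : countable R -> countable R' ->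
  R `<=` D 0%N -> (forall w, (forall n, D n w) -> R w) -> graded_inj D D' R R' g ->
  (forall x n, D n x -> ~ R x -> exists k, (n <= k)%N /\ ~ countable (D' k `\` D' k.+1)) ->
  exists G, borel_graded G.
Proof.
move=> cR cR' RD infR [gR gi gn] hk.
have /ex_choice[phi hphi] : forall k, exists phi, ~ countable (D' k `\` D' k.+1) ->
    [/\ contN phi, forall z, ((D' k `\` D' k.+1) `\` R') (phi z) &
      forall z z', binary z -> binary z' -> phi z = phi z' -> z = z'].
  move=> k; case: (pselect (countable (D' k `\` D' k.+1))) => ck; first by exists id.
  have [||phi h] := @perfect_set ((D' k `\` D' k.+1) `\` R').
  - apply: borelN_ana; apply: (sigma_and bS).
      exact: (sigma_and bS (bD' k) (sigma_not bS (bD' k.+1))).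
    exact: (sigma_not bS (countable_borelN cR')).
  - apply: (uncountable_remainder cR' _ ck) => w h.
    by case: (pselect (R' w)) => ?; [left|right].
  by exists phi.
have /ex_choice[kap hkap] : forall n, exists k, (exists x, D n x /\ ~ R x) ->
    (n <= k)%N /\ ~ countable (D' k `\` D' k.+1).
  move=> n; case: (pselect (exists x, D n x /\ ~ R x)) => [[x [Dx Rx]]|hn].
    by have [k h] := hk x n Dx Rx; exists k.
  by exists 0%N.
have /ex_choice[gr hgr] : forall x, exists n, D 0%N x -> ~ R x -> D n x /\ ~ D n.+1 x.
  move=> x; case: (pselect (D 0%N x /\ ~ R x)) => [[Dx Rx]|hn].
    by have [n h] := grade_exists Dx (fun h => Rx (infR _ h)); exists n.
  by exists 0%N => h1 h2; case: hn.
(* Grades with the same target layer share one embedding, distinct exact layers are disjoint, and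
   all embeddings avoid [R']; so injectivity reduces to that of each [phi k] on binary codes. *)
pose G x := if pselect (R x) then g x else phi (kap (gr x)) x.
have hx x : D 0%N x -> ~ R x -> [/\ D (gr x) x, ~ D (gr x).+1 x, (gr x <= kap (gr x))%N &
    ~ countable (D' (kap (gr x)) `\` D' (kap (gr x)).+1)].
  move=> Dx Rx; have [h1 h2] := hgr x Dx Rx.
  by have [|h3 h4] := hkap (gr x); first by exists x.
have graded n x : D 0%N x -> D n x -> D' n (G x).
  move=> Dx Dn; rewrite /G; case: pselect => Rx; first exact: gn.
  have [h1 h2 h3 h4] := hx x Dx Rx; have [_ /(_ x)[[Dk _] _] _] := hphi _ h4.
  apply: leD' Dk; apply: leq_trans h3; rewrite leqNgt; apply/negP => h; apply: h2.
  exact: leD Dn.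
exists G; split; first split => [x Dx|x y Dx Dy|n x Dx Dn].
- exact: graded.
- rewrite /G; case: pselect => Rx; case: pselect => Ry /= e.
  + exact: gi.
  + have [_ _ _ h4] := hx y Dy Ry; have [_ /(_ y)[_ []]] := hphi _ h4.
    by rewrite -e; exact: gR.
  + have [_ _ _ h4] := hx x Dx Rx; have [_ /(_ x)[_ []]] := hphi _ h4.
    by rewrite e; exact: gR.
  + have [_ _ _ h4] := hx x Dx Rx; have [_ /(_ x)[[p1 p2] _] inj] := hphi _ h4.
    have [_ _ _ h4'] := hx y Dy Ry; have [_ /(_ y)[[q1 q2] _] _] := hphi _ h4'.
    have ek : kap (gr x) = kap (gr y).
      case: (ltngtP (kap (gr x)) (kap (gr y))) => // h.
        by case: p2; rewrite e; apply: leD' q1.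
      by case: q2; rewrite -e; apply: leD' p1.
    by rewrite -ek in e; apply: inj e; exact: binD.
- exact: graded.
- move=> B bB.
  rewrite (_ : [set w | _] = [set w | (R w /\ B (g w)) \/ exists n,
      [/\ D n w, ~ D n.+1 w & ~ R w] /\ B (phi (kap n) w)]).
    apply: (sigma_or bS).
      apply: countable_borelN; apply: sub_countable cR; apply: subset_card_le.
      by move=> w [].
    apply: (sigma_ex bS) => n.
    case: (pselect (exists x, D n x /\ ~ R x)) => hn.
      apply: (sigma_and bS).
        rewrite (_ : [set w | _] = [set w | D n w /\ (~ D n.+1 w /\ ~ R w)]).
          apply: (sigma_and bS (bD n)).
          exact: (sigma_and bS (sigma_not bS (bD n.+1)) (sigma_not bS (countable_borelN cR))).
        by apply/seteqP; split => w /= => [[]|[? []]].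
      have [_ h4] := hkap n hn; have [cphi _ _] := hphi _ h4.
      exact: (borelN_preimage bS (contN_borel cphi) bB).
    rewrite (_ : [set w | _] = [set w | False]); first exact: (sigma_cst bS).
    by apply/seteqP; split => w //= [[? _ ?] _]; apply: hn; exists w.
  apply/seteqP; split => w /=; rewrite /G.
    case=> Dw; case: pselect => Rw Bw; first by left.
    by right; exists (gr w); have [? ? _ _] := hx w Dw Rw.
  case=> [[Rw Bw]|[n [[Dn nDn Rw] Bw]]].
    by split; [exact: RD|case: pselect].
  have Dw : D 0%N w by apply: leD Dn.
  split => //; case: pselect => //= nR; have [h1 h2 _ _] := hx w Dw Rw.
  suff -> : gr w = n by [].
  case: (ltngtP (gr w) n) => // h.
    by case: h2; apply: leD Dn.
  by case: nDn; apply: leD h1.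
Qed.

(** An uncountable intersection of the [D' n] absorbs all of [D 0] into one Cantor set. Otherwise
    the countable part is [D N] for the least [N] with [D' N] countable, treated by shifting both
    sequences by [N], or the intersection of the [D n] if there is no such [N]. *)
Theorem borel_graded_inj : exists G, graded_inj D D' (D 0%N) (D' 0%N) G /\
  forall B, borelN B -> borelN [set w | D 0%N w /\ B (G w)].
Proof.
case: (pselect (countable [set w | forall n, D' n w])) => [cinf'|ninf']; last first.
  have binf : borelN [set w | forall n, D' n w] by exact: (sigma_all bS).
  have [phi [cphi phiD phii]] := perfect_set (borelN_ana binf) ninf'.
  exists phi; split.
    split => [x _|x y Dx Dy|n x _ _]; [exact: phiD| |exact: phiD].
    by apply: phii; exact: binD.
  move=> B bB.
  exact: (sigma_and bS (bD 0%N) (borelN_preimage bS (contN_borel cphi) bB)).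
case: (pselect (exists n, countable (D' n))) => [hc|hnc].
  have ex : exists n, `[< countable (D' n) >] by have [n ?] := hc; exists n; apply/asboolP.
  have [N /asboolP cN hN] := ex_minnP ex.
  have shift_inf (C : nat -> set baire) : (forall n, C n.+1 `<=` C n) ->
      [set w | forall n, C (N + n)%N w] = [set w | forall n, C n w].
    move=> dC; apply/seteqP; split => w /= h n; last exact: h.
    by apply: (decreasing_le dC (leq_addl N n)); exact: h.
  have [|||||g [gD gi gn]] := @graded_inj_countable (fun n => D (N + n)%N) (fun n => D' (N + n)%N).
  - by move=> n; rewrite addnS; exact: dD.
  - by move=> n; rewrite addnS; exact: dD'.
  - by move=> n; exact: cD.
  - by rewrite !shift_inf.
  - by rewrite addn0.
  rewrite !addn0 in gD gi gn.
  have hg : graded_inj D D' (D N) (D' N) g.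
    split => // n x Dx Dn; case: (leqP n N) => h.
      by apply: (leD' h); exact: gD.
    by have := gn (n - N)%N x Dx; rewrite subnKC ?(ltnW h) //; apply.
  apply: (borel_graded_glue _ cN _ _ hg).
  - exact: sub_countable (cD N) cN.
  - exact: leD.
  - by move=> w; apply.
  - move=> x n Dn Nx; apply: uncountable_layer => // cn.
    have := hN n (asboolT cn); move=> Nn; apply: Nx; exact: leD Dn.
have [g [gD gi]] := card_le_baireP cinf.
have hg : graded_inj D D' [set w | forall n, D n w] [set w | forall n, D' n w] g.
  by split => // n x /gD.
apply: (borel_graded_glue _ cinf' _ _ hg) => //.
- exact: sub_countable cinf cinf'.
- move=> x n _ _; apply: uncountable_layer => // cn; apply: hnc; by exists n.
Qed.

End BorelGradedInjection.

(** * The coarse relative shape *)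

Section ShapeOfNormalForm.
Variables (R : realType) (X : standardBorelType R) (E F : X -> X -> Prop)
  (f : X -> baire) (i : X -> nat) (T : set X).
Hypothesis nf : normal_form E F f i T.

(** As the numbers in use form an initial segment, an [F]-class has an [E]-class numbered [n]
    exactly when it has more than [n] of them. *)
Definition layer n : set baire := f @` [set x | i x = n].

Lemma layer_borel n : borelN (layer n).
Proof. by apply: (nf_image nf); exact: (nf_index nf). Qed.

Lemma layer_le x m : (m <= i x)%N -> layer m (f x).
Proof.
rewrite leq_eqVlt => /orP[/eqP ->|h]; first by exists x.
by have [y [fy iy]] := nf_initial nf h; exists y.
Qed.

Lemma layer_decreasing n : layer n.+1 `<=` layer n.
Proof. by move=> _ [x ix <-]; apply: layer_le; rewrite ix. Qed.

(** The [E]-classes inside the [F]-class over [w] correspond to the indices [j] that occur there, so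
    [at_least m] can be tested on indices; [layer 0] says that [w] codes a class at all. *)
Lemma crs_classes_image m : crs_classes E F m =
  (fun w => [set y | f y = w]) @`
    [set w | layer 0%N w /\ at_least m [set j | layer j w]].
Proof.
have clsF x : [set y | F x y] = [set y | f y = f x].
  by apply/seteqP; split => y /=; rewrite (nf_F nf).
have cardE w : [set A | equiv_classes E A /\ A `<=` [set y | f y = w]] #=
    [set j | layer j w].
  have -> : [set A | equiv_classes E A /\ A `<=` [set y | f y = w]] =
      (fun j => [set y | f y = w /\ i y = j]) @` [set j | layer j w].
    apply/seteqP; split => A /=.
    - case=> -[x _ <-] sub.
      have fx : f x = w by apply: sub; apply/(nf_E nf).
      exists (i x); first by exists x.
      by apply/seteqP; split => y /=; rewrite (nf_E nf) fx => -[-> ->].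
    - case=> j [x ix fx] <-; split; last by move=> y [].
      by exists x => //; apply/seteqP; split => y /=; rewrite (nf_E nf) fx ix => -[-> ->].
  apply: inj_card_eq => j j' /[!inE] -[x /= ix fx] _ e.
  have : [set y | f y = w /\ i y = j] x by [].
  by rewrite e => -[_ <-].
have al w : at_least m [set A | equiv_classes E A /\ A `<=` [set y | f y = w]] <->
    at_least m [set j | layer j w].
  case: m => [k|] /=; first by rewrite (card_le_eqr (cardE w)).
  by rewrite (eq_finite_set (cardE w)).
apply/seteqP; split => C /=.
- case=> -[x _ <-]; rewrite clsF => /al h; exists (f x) => //; split => //.
  exact: layer_le.
- case=> w [[x _ fx] /al h] <-; split => //.
  by exists x => //; rewrite clsF fx.
Qed.

Lemma crs_classes_card m : crs_classes E F m #=
  [set w | layer 0%N w /\ at_least m [set j | layer j w]].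
Proof.
rewrite crs_classes_image; apply: inj_card_eq => w w' /[!inE] -[[x /= _ fx] _] _ e.
have : [set y | f y = w] x by [].
by rewrite e /= fx.
Qed.

(** Indices start at 0 and the layers decrease: at least [n+1] indices occur exactly when [n]
    does. *)
Lemma crs_classes_Fin n : crs_classes E F (Fin n.+1) #= layer n.
Proof.
apply: card_eq_trans (crs_classes_card _) _.
rewrite [X in X #= _](_ : _ = layer n) //; apply/seteqP; split => w /=.
- case=> _ h; apply: contrapT => nw.
  have : [set j | layer j w] `<=` `I_n.
    move=> j lj; rewrite /= ltnNge; apply/negP => nj; apply: nw.
    exact: decreasing_le layer_decreasing _ _ nj _ lj.
  by move=> /subset_card_le/(card_le_trans h); rewrite card_le_II ltnn.
- move=> h; have le := decreasing_le layer_decreasing; split; first exact: le h.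
  by apply: subset_card_le => j /= jn; apply: le h.
Qed.

Lemma crs_classes_Omega : crs_classes E F Omega #= [set w | forall n, layer n w].
Proof.
apply: card_eq_trans (crs_classes_card _) _.
rewrite [X in X #= _](_ : _ = [set w | forall n, layer n w]) //.
apply/seteqP; split => w /=.
- case=> _ h n; apply: contrapT => nw; apply: h.
  apply: sub_finite_set (finite_II n) => j lj; rewrite /= ltnNge; apply/negP => nj.
  by apply: nw; exact: decreasing_le layer_decreasing _ _ nj _ lj.
- move=> h; split => //; rewrite (_ : [set j | _] = setT); first exact: infinite_nat.
  by apply/seteqP; split => // j _; exact: h.
Qed.

End ShapeOfNormalForm.

(** * Reductions against shapes *)

Section Reductions.
Variables (R : realType) (X Y : standardBorelType R)
  (E F : X -> X -> Prop) (E' F' : Y -> Y -> Prop)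
  (f : X -> baire) (i : X -> nat) (T : set X)
  (f' : Y -> baire) (i' : Y -> nat) (T' : set Y).
Hypotheses (nf : normal_form E F f i T) (nf' : normal_form E' F' f' i' T').

Let D := layer f i.
Let D' := layer f' i'.

Lemma crs_leP : crs_le E F E' F' <->
  (forall n, D n #<= D' n) /\ [set w | forall n, D n w] #<= [set w | forall n, D' n w].
Proof.
have hF n : (crs_classes E F (Fin n.+1) #<= crs_classes E' F' (Fin n.+1)) = (D n #<= D' n).
  by rewrite (card_le_eql (crs_classes_Fin nf n)) (card_le_eqr (crs_classes_Fin nf' n)).
have hO : (crs_classes E F Omega #<= crs_classes E' F' Omega) =
    ([set w | forall n, D n w] #<= [set w | forall n, D' n w]).
  by rewrite (card_le_eql (crs_classes_Omega nf)) (card_le_eqr (crs_classes_Omega nf')).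
split => [h|[h1 h2] [[|n]|] //= _]; last 2 first.
- by rewrite hF.
- by rewrite hO.
by split => [n|]; [rewrite -hF; exact: h|rewrite -hO; exact: h].
Qed.

(* If [w] is in layer [n] then the [n.+1] representatives of its [E]-classes have
   distinct images, so one of them has index at least [n]. *)
Lemma reducible_crs_le : simul_borel_reducible E F E' F' -> crs_le E F E' F'.
Proof.
case=> r [_ rE rF].
(* The map induced by [r] on codes of [F]-classes, with default [w] off the image of [f]. *)
have /ex_choice[s hs] : forall w, exists w', forall x, f x = w -> w' = f' (r x).
  move=> w; case: (pselect (exists x, f x = w)) => [[x fx]|hn].
    exists (f' (r x)) => y fy; apply/(nf_F nf')/rF/(nf_F nf).
    by rewrite fx fy.
  by exists w => x fx; case: hn; exists x.
have sD n w : D n w -> D' n (s w).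
  move=> Dn; have le := decreasing_le (layer_decreasing nf).
  have /ex_choice[x hx] : forall j, exists x, (j <= n)%N -> f x = w /\ i x = j.
    move=> j; case: (leqP j n) => jn; last by case: Dn => x _ _; exists x.
    by have [x ix fx] := le _ _ jn _ Dn; exists x.
  have fx j : (j <= n)%N -> f' (r (x j)) = s w.
    by move=> /hx[? _]; apply/esym/hs.
  have inj : {in `I_n.+1 &, injective (fun j => i' (r (x j)))}.
    move=> j k /[!inE] /= jn kn e.
    have : E (x j) (x k) by apply/rE/(nf_E nf'); rewrite !fx.
    by move=> /(nf_E nf)[_]; have [_ ->] := hx j jn; have [_ ->] := hx k kn.
  apply: contrapT => nD.
  suff : `I_n.+1 #<= `I_n by rewrite card_le_II ltnn.
  rewrite -(card_le_eql (inj_card_eq inj)); apply: subset_card_le => _ [j /= jn <-].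
  rewrite ltnNge; apply/negP => nj; apply: nD; rewrite -(fx j jn).
  exact: (layer_le nf').
have si w w' : D 0%N w -> D 0%N w' -> s w = s w' -> w = w'.
  move=> [x _ <-] [y _ <-]; rewrite (hs _ x erefl) (hs _ y erefl) => e.
  by apply/(nf_F nf)/rF/(nf_F nf').
have le (A : set baire) (B : set baire) : A `<=` D 0%N -> (forall w, A w -> B (s w)) ->
    A #<= B.
  move=> AD sAB; have e : s @` A #= A.
    by apply: inj_card_eq => w w' /[!inE] /AD ? /AD ?; exact: si.
  by rewrite -(card_le_eql e); apply: subset_card_le => _ [w Aw <-]; exact: sAB.
apply/crs_leP; split => [n|].
  by apply: le; [exact: decreasing_le (layer_decreasing nf) _ _ _|exact: sD].
by apply: le => [w|w h n]; [apply|exact: sD].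
Qed.

Lemma crs_le_reducible : crs_le E F E' F' -> simul_borel_reducible E F E' F'.
Proof.
move=> /crs_leP[cD cinf].
have bX := borel_sigma X; have bY := borel_sigma Y.
have [|||||||G [[GD Gi Gn] bG]] := @borel_graded_inj D D'.
- exact: (layer_decreasing nf).
- exact: (layer_decreasing nf').
- exact: (layer_borel nf).
- exact: (layer_borel nf').
- by move=> _ [x _ <-]; exact: (nf_binary nf).
- exact: cD.
- exact: cinf.
have D0 x : D 0%N (f x) by exact: (layer_le nf).
(* Since [G] is graded, the class over [G (f x)] has an [E']-class numbered [i x]; the transversal
   [T'] makes the chosen point unique. *)
have /ex_choice[r hr] : forall x, exists y, [/\ T' y, f' y = G (f x) & i' y = i x].
  move=> x; have [y iy fy] : D' (i x) (G (f x)) by apply: Gn => //; exists x.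
  have [z [Tz fz iz]] := nf_meets nf' y; exists z.
  by rewrite fz iz fy iy.
exists r; split.
- move=> B bB.
  (* By that uniqueness, [r x] is in [B] exactly when [G (f x)] is in the image of the part of [B]
     in [T'] with index [i x], and this image is Borel. *)
  rewrite (_ : _ @^-1` _ = [set x | exists n, i x = n /\
      (D 0%N (f x) /\ (f' @` [set y | B y /\ (T' y /\ i' y = n)]) (G (f x)))]).
    apply: (sigma_ex bX) => n; apply: (sigma_and bX); first exact: (nf_index nf).
    apply: (borelN_preimage bX (nf_map nf)
      (B := [set w | D 0%N w /\ (f' @` [set y | B y /\ (T' y /\ i' y = n)]) (G w)])).
    apply: bG; apply: (nf_image nf').
    apply: (sigma_and bY) => //; apply: (sigma_and bY); first exact: (nf_transversal nf').
    exact: (nf_index nf').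
  apply/seteqP; split => x /=; have [Tr fr ir] := hr x.
    by move=> Br; exists (i x); do 2!split => //; exists (r x).
  case=> n [ix [_ [y [By [Ty iy]] fy]]].
  by rewrite (nf_unique nf' Tr Ty) // ?fr ?fy // ir ix iy.
- move=> x y; have [_ fx ix] := hr x; have [_ fy iy] := hr y.
  rewrite (nf_E nf) (nf_E nf') fx fy ix iy.
  by split => -[e ->]; split => //; [rewrite e|exact: Gi].
- move=> x y; have [_ fx ix] := hr x; have [_ fy iy] := hr y.
  rewrite (nf_F nf) (nf_F nf') fx fy.
  by split => [->//|e]; exact: Gi.
Qed.

End Reductions.

(** Cantor-Bernstein, at each index separately. *)
Lemma crs_eqP (T U : Type) (E F : T -> T -> Prop) (E' F' : U -> U -> Prop) :
  crs_eq E F E' F' <-> crs_le E F E' F' /\ crs_le E' F' E F.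
Proof.
split => [h|[h1 h2] m vm].
  by split => m vm; have := h m vm; rewrite card_eq_le => /andP[].
by rewrite card_eq_le h1 // h2.
Qed.

Theorem theorem5p1 (R : realType) (X Y : standardBorelType R)
    (E F : X -> X -> Prop) (E' F' : Y -> Y -> Prop)
    (hE : countable_borel_equiv E) (sE : smooth E)
    (hF : countable_borel_equiv F) (sF : smooth F)
    (EF : forall x y : X, E x y -> F x y)
    (hE' : countable_borel_equiv E') (sE' : smooth E')
    (hF' : countable_borel_equiv F') (sF' : smooth F')
    (EF' : forall x y : Y, E' x y -> F' x y) :
  (simul_borel_reducible E F E' F' <-> crs_le E F E' F') /\
  (simul_borel_bireducible E F E' F' <-> crs_eq E F E' F').
Proof.
have [_ _ cF] := hF; have [_ _ cF'] := hF'.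
have [f [i [T nf]]] := smooth_normal_form sE sF cF EF.
have [f' [i' [T' nf']]] := smooth_normal_form sE' sF' cF' EF'.
have main := conj (reducible_crs_le nf nf') (crs_le_reducible nf nf').
have main' := conj (reducible_crs_le nf' nf) (crs_le_reducible nf' nf).
split; first exact: main.
by rewrite crs_eqP /simul_borel_bireducible; split => -[h h'];
  split; [apply/main|apply/main'|apply/main|apply/main'].
Qed.
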